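(* Let $d\ge 1$ and $0<q<\infty$. There exist two positive constants $C_1(d,q)$ and $C_2(d,q)$, depending only on $d$ and $q$, such that for every integer $N\ge 1$, every measurable set $B\subset\mathbb{T}^d$ of normalized measure $|B|\le (C_2(d,q)N)^{-1}$ and every $f\in\mathcal{T}(N)$, $$\|f\|_q\le C_1(d,q)\,\|f\|_{L_q(\mathbb{T}^d\setminus B)}.$$
   Context: $\mathbb{T}^d$ is the $d$-dimensional torus $[0,2\pi)^d$ (functions are $2\pi$-periodic in each variable) with normalized Lebesgue measure $\mu$, $\mu(\mathbb{T}^d)=1$, and $|B|=\mu(B)$. For $0<q<\infty$ and measurable $E\subset\mathbb{T}^d$, $\|f\|_{L_q(E)}=\big(\int_E|f|^q\,d\mu\big)^{1/q}$ and $\|f\|_q=\|f\|_{L_q(\mathbb{T}^d)}$. The hyperbolic cross is $$\Gamma(N):=\Big\{\mathbf{k}=(k_1,\dots,k_d)\in\mathbb{Z}^d:\ \prod_{j=1}^d\bar k_j\le N\Big\},\qquad \bar k_j:=\max(1,|k_j|),$$ and $$\mathcal{T}(N):=\Big\{f:\ f(\mathbf{x})=\sum_{\mathbf{k}\in\Gamma(N)}c_{\mathbf{k}}e^{i(\mathbf{k},\mathbf{x})},\ c_{\mathbf{k}}\in\mathbb{C}\Big\}.$$ *)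

(* Defs.v *)
From HB Require Import structures.
From mathcomp Require Import all_boot all_order all_algebra.
From mathcomp Require Import complex.
From mathcomp Require Import all_classical all_reals all_analysis.

Set Implicit Arguments.
Unset Strict Implicit.
Unset Printing Implicit Defensive.

Import Order.TTheory GRing.Theory Num.Theory.
Import numFieldNormedType.Exports.

Local Open Scope classical_set_scope.
Local Open Scope ring_scope.

Lemma twopi_gt0 (R : realType) : 0 < 2 * pi :> R.
Proof. by rewrite mulr_gt0 ?pi_gt0. Qed.

Definition tcons (R : realType) (n : nat)
    (p : measurableTypeR R * n.-tuple (measurableTypeR R)) :
    n.+1.-tuple (measurableTypeR R) :=
  [tuple of p.1 :: p.2].

Lemma measurable_tcons (R : realType) (n : nat) :
  measurable_fun setT (@tcons R n).
Proof. exact: measurable_cons. Qed.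

HB.instance Definition _ (R : realType) (n : nat) :=
  isMeasurableFun.Build _ _ _ _ (@tcons R n) (@measurable_tcons R n).

(* The library has no n-fold product measure. This is the n-fold product of the
   uniform probability on [0, 2pi], built on the Borel sets of R^n. *)
Fixpoint borel_torus (R : realType) (n : nat) :
    probability (n.-tuple (measurableTypeR R)) R :=
  match n with
  | 0 => \d_([tuple] : 0.-tuple (measurableTypeR R))
  | m.+1 =>
    distribution (uniform_prob (twopi_gt0 R) \x borel_torus R m)%E (@tcons R m)
  end.

(* R^d with the sigma-algebra of Lebesgue measurable sets (more precisely, the
   sets measurable for the completion of borel_torus, so that what happens
   outside [0, 2pi)^d is irrelevant). *)
Definition lspace (R : realType) (d : nat) :=
  caratheodory_type (mu_ext (borel_torus R d)).

HB.instance Definition _ (R : realType) (d : nat) :=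
  Measurable.on (lspace R d).

(* Normalized Lebesgue measure on [0, 2pi)^d; see torus_measure_box below. *)
Definition torus_measure (R : realType) (d : nat) :
    {measure set (lspace R d) -> \bar R} :=
  @completed_measure_extension _ (d.-tuple (measurableTypeR R)) R
    (borel_torus R d).

Definition torus (R : realType) (d : nat) : set (lspace R d) :=
  [set x : d.-tuple R | forall i, 0 <= tnth x i < 2 * pi].

Arguments torus : clear implicits.

Definition Lq_norm (R : realType) (d : nat) (q : R) (E : set (lspace R d))
    (f : d.-tuple R -> R[i]) : \bar R :=
  (poweR (\int[torus_measure R d]_(x in E) (Normc.normc (f x) `^ q)%:E) q^-1)%E.

Definition hyperbolic_cross (d N : nat) : set (d.-tuple int) :=
  [set k : d.-tuple int | (\prod_(j < d) maxn 1 `|tnth k j| <= N)%N].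

Arguments hyperbolic_cross : clear implicits.

Definition expi (R : realType) (t : R) : R[i] := (cos t +i* sin t)%C.

Definition char_torus (R : realType) (d : nat) (k : d.-tuple int)
    (x : d.-tuple R) : R[i] :=
  expi (\sum_(j < d) (tnth k j)%:~R * tnth x j).

Definition trig_cross (R : realType) (d N : nat) : set (d.-tuple R -> R[i]) :=
  [set f | exists c : d.-tuple int -> R[i],
     forall x, f x = \sum_(k \in hyperbolic_cross d N) c k * char_torus k x].

Arguments trig_cross : clear implicits.

(* Finiteness matters: \sum_(k \in A) is 0 by convention on infinite supports. *)
Lemma finite_hyperbolic_cross (d N : nat) : finite_set (hyperbolic_cross d N).
Proof.
pose g (t : {ffun 'I_d -> 'I_N.+1 * bool}) : d.-tuple int :=
  [tuple (if (t j).2 then - ((t j).1 : nat)%:Z else ((t j).1 : nat)%:Z) | j < d].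
apply: (@sub_finite_set _ _ (g @` setT)); last first.
  by apply: finite_image; exact: finite_finset.
move=> k /= kN.
have kj j : (`|tnth k j| < N.+1)%N.
  rewrite ltnS; apply: leq_trans kN.
  rewrite (bigD1 j)//= (leq_trans (leq_maxr 1 _))// leq_pmulr//.
  by apply: prodn_gt0 => i; rewrite leq_max.
exists [ffun j => (Ordinal (kj j), tnth k j < 0)] => //.
apply: eq_from_tnth => j; rewrite tnth_mktuple !ffunE /=.
by case: ltP => h; rewrite abszE ?(ltr0_norm h) ?opprK ?(ger0_norm h).
Qed.

Section torus_measure_facts.
Variable R : realType.
Local Notation mR := (measurableTypeR R).
Local Open Scope ereal_scope.

Let box n (A : 'I_n -> set mR) : set (n.-tuple mR) :=
  [set x | forall i, A i (tnth x i)].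

Let measurable_box n (A : 'I_n -> set mR) :
  (forall i, measurable (A i)) -> measurable (box A).
Proof.
move=> mA; rewrite (_ : box A = \bigcap_(i in [set: 'I_n]) ((@tnth n mR)^~ i @^-1` A i)).
  apply: fin_bigcap_measurable => // i _.
  by rewrite -[X in measurable X]setTI; exact: measurable_tnth.
by apply/seteqP; split => [x xA i _|x xA i] /=; exact: xA.
Qed.

Lemma uniform_probE (A : set mR) : measurable A -> A `<=` `[0%R, (2 * pi)%R[ ->
  uniform_prob (twopi_gt0 R) A = ((2 * pi)^-1)%:E * lebesgue_measure A.
Proof.
move=> mA A02; rewrite /uniform_prob -integral_cst//.
apply: eq_integral => x /set_mem /A02 /=; rewrite in_itv/= => /andP[x0 x2].
by rewrite /uniform_pdf x0 (ltW x2) subr0.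
Qed.

Lemma borel_torus_box n (A : 'I_n -> set mR) : (forall i, measurable (A i)) ->
  borel_torus R n (box A) = \prod_(i < n) uniform_prob (twopi_gt0 R) (A i).
Proof.
elim: n A => [|n IH] A mA.
  rewrite big_ord0 /= diracE (_ : _ \in _ = true)//.
  by apply/mem_set => -[].
rewrite big_ord_recl -IH// -product_measure1E//; last exact: measurable_box.
rewrite [LHS]/=/distribution/= /pushforward; congr (_ _).
apply/seteqP; split => [[x t]/= xA|[x t] [/= x0 tA] i].
  split => [|i]; first by have := xA ord0; rewrite (tnth_nth x).
  by have := xA (lift ord0 i); rewrite /tcons tnthS.
by case: (unliftP ord0 i) => [j ->|->]; rewrite /tcons/= ?tnthS.
Qed.

Lemma torus_measure_box d (A : 'I_d -> set mR) : (forall i, measurable (A i)) ->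
  (forall i, A i `<=` `[0%R, (2 * pi)%R[) ->
  torus_measure R d [set x : d.-tuple R | forall i, A i (tnth x i)] =
  \prod_(i < d) (((2 * pi)^-1)%:E * lebesgue_measure (A i)).
Proof.
move=> mA A02; rewrite -[LHS]/(mu_ext (borel_torus R d) (box A)).
rewrite measurable_mu_extE/=; last exact: measurable_box.
by rewrite borel_torus_box//; apply: eq_bigr => i _; rewrite uniform_probE.
Qed.

Lemma torus_measure_torus d : torus_measure R d (torus R d) = 1.
Proof.
rewrite (_ : torus R d =
   [set x : d.-tuple R | forall i, `[0%R, (2 * pi)%R[%classic (tnth x i)]).
  rewrite (@torus_measure_box d (fun=> `[0%R, (2 * pi)%R[%classic))//; last by move=> _ y.
  rewrite big1// => i _.
  rewrite lebesgue_measure_itv/= lte_fin twopi_gt0 sube0 -EFinM mulVf//.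
  by rewrite gt_eqF// twopi_gt0.
by apply/seteqP; split => x /= + i => /(_ i); rewrite in_itv.
Qed.

End torus_measure_facts.

(* Main.v *)
Require Import Defs.
From mathcomp Require Import all_boot all_order all_algebra.
From mathcomp Require Import complex.
From mathcomp Require Import all_classical all_reals all_analysis.
From mathcomp Require Import measurable_realfun ring lra zify.

(** The key is the Nikolskii inequality without logarithms: for every large even
    [r] and every [f] in [trig_cross N], [||f||_{2r}^{2r} <= C N ||f||_r^{2r}].
    Given this, truncating [|f|] at a suitable height bounds the integral of
    [|f|^q] over [B] by half of the integral over the torus, for every [q <= r].

    The Nikolskii inequality is first proved for averages over the grid of the
    points with coordinates [2 pi j / M], and [M] is then sent to infinity. On
    the grid a real polynomial [F] is a sum of dyadic pieces [g_s], with [s]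
    ranging over the multi-indices such that [2^|s| <= 2^d N], obtained by
    convolution with differences of de la Vallee-Poussin kernels. Three facts
    suffice, and none needs Littlewood-Paley theory:
    - the sum over [s] of the averages [E |g_s|^r] is at most [C E |F|^r], by
      interpolation between Bessel's inequality and the uniform bound;
    - [g_s] varies slowly at scale [2^(- s_j)] in each coordinate [j], so that
      [E (|g_s|^r |g_t|^r) <= C 2^(sum_j min (s_j, t_j)) E |g_s|^r E |g_t|^r],
      which gains [2^(- |s - t| / 2)] over the geometric mean of the diagonal terms;
    - this off-diagonal gain makes [E (sum_s |g_s|)^(2r)] comparable to the sum
      of the diagonal terms [2^|s| (E |g_s|^r)^2], hence at most
      [C N (E |F|^r)^2]. *)

Set Implicit Arguments.
Unset Strict Implicit.
Unset Printing Implicit Defensive.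

Import Order.TTheory GRing.Theory Num.Theory.
Import numFieldNormedType.Exports.

Local Open Scope classical_set_scope.
Local Open Scope ring_scope.

(** * Averages over equispaced nodes of the circle, and discrete convolution *)

Section Averages.
Variable R : realType.
Implicit Types (M K k l n : nat) (h g : R -> R) (a b : nat -> R) (x y t : R).

Definition node M j : R := 2 * pi * j%:R / M%:R.
Definition nodes M : seq R := [seq node M j | j <- iota 0 M].
Definition avg M h : R := M%:R^-1 * \sum_(x <- nodes M) h x.

Lemma avgE M h : avg M h = M%:R^-1 * \sum_(j < M) h (node M j).
Proof. by rewrite /avg big_map (_ : iota 0 M = index_iota 0 M) ?big_mkord// /index_iota subn0. Qed.

Lemma eq_avg M h g : h =1 g -> avg M h = avg M g.
Proof. by move=> hg; congr (_ * _); apply: eq_bigr => x _. Qed.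

Lemma avgD M h g : avg M (fun x => h x + g x) = avg M h + avg M g.
Proof. by rewrite /avg big_split mulrDr. Qed.

Lemma avgZ M c h : avg M (fun x => c * h x) = c * avg M h.
Proof. by rewrite /avg -big_distrr /= mulrCA. Qed.

Lemma avg_sum M (I : Type) (r : seq I) (F : I -> R -> R) :
  avg M (fun x => \sum_(i <- r) F i x) = \sum_(i <- r) avg M (F i).
Proof. by rewrite /avg exchange_big big_distrr. Qed.

Lemma avg_cst M c : (0 < M)%N -> avg M (fun=> c) = c.
Proof.
move=> M0; rewrite avgE sumr_const card_ord -[c *+ M]mulr_natl mulKf//.
by rewrite pnatr_eq0 -lt0n.
Qed.

Lemma le_avg M h g : (forall x, h x <= g x) -> avg M h <= avg M g.
Proof. by move=> hg; rewrite ler_wpM2l ?invr_ge0// ler_sum. Qed.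

Lemma avg_ge0 M h : (forall x, 0 <= h x) -> 0 <= avg M h.
Proof. by move=> h0; rewrite mulr_ge0 ?invr_ge0// sumr_ge0. Qed.

Lemma ler_norm_avg M h : `|avg M h| <= avg M (fun x => `|h x|).
Proof.
by rewrite normrM ger0_norm ?invr_ge0// ler_wpM2l ?invr_ge0// ler_norm_sum.
Qed.

Lemma exchange_avg M (F : R -> R -> R) :
  avg M (fun x => avg M (F x)) = avg M (fun y => avg M (F^~ y)).
Proof.
rewrite {1 3}/avg; congr (_ * _); rewrite -!big_distrr /=.
by rewrite exchange_big.
Qed.

(** After multiplication by [sin (pi k / M)] the sum over the nodes telescopes and closes up by
    periodicity. That sine is nonzero because [0 < k < M]. *)
Lemma avg_cos M k (phi : R) : (0 < k < M)%N ->
  avg M (fun x => cos (k%:R * x + phi)) = 0.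
Proof.
case/andP=> k0 kM; have M0 : M%:R != 0 :> R.
  by rewrite pnatr_eq0 -lt0n (ltn_trans k0).
pose e : R := pi * k%:R / M%:R.
have se : sin e != 0.
  rewrite gt_eqF// sin_gt0_pi// /e divr_gt0 ?mulr_gt0 ?pi_gt0 ?ltr0n//=; last first.
    by rewrite (ltn_trans k0).
  by rewrite ltr_pdivrMr ?ltr_pM2l ?pi_gt0 ?ltr_nat// ltr0n (ltn_trans k0).
rewrite avgE; apply/eqP; rewrite mulf_eq0 invr_eq0 (negPf M0)/=; apply/eqP.
apply: (mulfI se); rewrite mulr0 big_distrr /=.
pose S j := sin (2 * e * j%:R + phi - e) / 2.
rewrite (eq_bigr (fun j : 'I_M => S j.+1 - S j)); last first.
  move=> j _; rewrite /S (_ : 2 * e * j.+1%:R + phi - e = (k%:R * node M j + phi) + e).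
    rewrite (_ : 2 * e * j%:R + phi - e = (k%:R * node M j + phi) - e).
      by rewrite sinD sinB; field.
    by rewrite /node /e; field.
  by rewrite /node /e -natr1; field.
rewrite -(big_mkord xpredT (fun j => S j.+1 - S j)) telescope_sumr// /S.
rewrite (_ : 2 * e * M%:R + phi - e = phi - e + pi *+ 2 *+ k); last first.
  by rewrite /e -[pi *+ 2]mulr_natl -[_ *+ k]mulr_natl; field.
rewrite periodicn; last exact: sinD2pi.
by rewrite mulr0 add0r subrr.
Qed.

Lemma mulr_cos_cos x y : cos x * cos y = (cos (x - y) + cos (x + y)) / 2 :> R.
Proof. by rewrite cosB cosD; field. Qed.

(** The product formula reduces this to [avg_cos]. The condition [2 * K <= M] keeps the frequency
    [k + l] below [M], so that no aliasing occurs. *)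
Lemma avg_cos_cos M K k l (phi psi : R) : (2 * K <= M)%N -> (k < K)%N -> (l < K)%N ->
  avg M (fun y => cos (k%:R * y + phi) * cos (l%:R * y + psi)) =
  (k == l)%:R * (if k == 0%N then cos phi * cos psi else cos (phi - psi) / 2).
Proof.
move=> KM kK lK; have M0 : (0 < M)%N by lia.
have [<-|kl] := eqVneq k l.
  have [->|k0] := eqVneq k 0%N.
    rewrite mul1r -[RHS](avg_cst _ M0); apply: eq_avg => y.
    by rewrite !mul0r !add0r.
  rewrite mul1r (@eq_avg _ _ (fun y =>
      2^-1 * cos (phi - psi) + 2^-1 * cos ((2 * k)%:R * y + (phi + psi)))).
    rewrite avgD avg_cst// avgZ avg_cos; last by lia.
    by rewrite mulr0 addr0 mulrC.
  move=> y; rewrite mulr_cos_cos natrM.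
  rewrite (_ : _ - (_ + psi) = phi - psi); last by ring.
  rewrite (_ : _ + (_ + psi) = 2 * k%:R * y + (phi + psi)); last by ring.
  by field.
rewrite mul0r.
have E : forall k l (phi psi : R), (k < l)%N -> (l < K)%N ->
  avg M (fun y => cos (k%:R * y + phi) * cos (l%:R * y + psi)) = 0.
  move=> {kK lK kl phi psi}k {}l phi psi kl lK.
  rewrite (@eq_avg _ _ (fun y =>
      2^-1 * cos ((l - k)%:R * y + (psi - phi)) +
      2^-1 * cos ((k + l)%:R * y + (phi + psi)))).
    by rewrite avgD !avgZ !avg_cos ?mulr0 ?addr0//; lia.
  move=> y; rewrite mulrC mulr_cos_cos natrB ?(ltnW kl)// natrD.
  rewrite (_ : _ - (_ + phi) = (l%:R - k%:R) * y + (psi - phi)); last by ring.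
  rewrite (_ : _ + (_ + phi) = (k%:R + l%:R) * y + (phi + psi)); last by ring.
  by field.
have [kl'|lk|kl'] := ltngtP k l; [exact: E| |by rewrite kl' eqxx in kl].
by under eq_avg do rewrite mulrC; exact: E.
Qed.

(** With these weights [kern] is the real form of the sum of [a_|k| e^(ikt)] over [|k| < K]: each
    positive frequency stands for two. *)
Definition cweight k : R := if k == 0%N then 1 else 2.

Definition kern K a t : R := \sum_(k < K) cweight k * a k * cos (k%:R * t).

Definition conv M K a h x : R := avg M (fun y => kern K a (x - y) * h y).

Lemma kernN K a t : kern K a (- t) = kern K a t.
Proof. by apply: eq_bigr => k _; rewrite mulrN cosN. Qed.

Lemma eq_conv M K a b h g x : (forall k, (k < K)%N -> a k = b k) -> h =1 g ->
  conv M K a h x = conv M K b g x.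
Proof.
move=> ab hg; apply: eq_avg => y; rewrite hg; congr (_ * _).
by apply: eq_bigr => k _; rewrite ab.
Qed.

Lemma conv_sum M K a (I : Type) (r : seq I) (c : I -> R) (F : I -> R -> R) x :
  conv M K a (fun y => \sum_(i <- r) c i * F i y) x =
  \sum_(i <- r) c i * conv M K a (F i) x.
Proof.
rewrite -(eq_bigr _ (fun i _ => avgZ M (c i) _)) -avg_sum; apply: eq_avg => y.
by rewrite big_distrr; apply: eq_bigr => i _; exact: mulrCA.
Qed.

Lemma conv_symbol_sum M K (I : Type) (r : seq I) (c : I -> R) (a : I -> nat -> R) h x :
  conv M K (fun k => \sum_(i <- r) c i * a i k) h x =
  \sum_(i <- r) c i * conv M K (a i) h x.
Proof.
rewrite -(eq_bigr _ (fun i _ => avgZ M (c i) _)) -avg_sum; apply: eq_avg => y.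
rewrite /kern; under eq_bigr => k _ do rewrite big_distrr/= big_distrl/=.
rewrite exchange_big big_distrl; apply: eq_bigr => i _ /=.
by rewrite mulrA big_distrr/=; congr (_ * _); apply: eq_bigr => k _; ring.
Qed.

(** Convolution with an even kernel is a Fourier multiplier. Expanding the kernel and using
    orthogonality leaves only the frequency [l]. *)
Lemma conv_cos M K a l (phi x : R) : (2 * K <= M)%N -> (l < K)%N ->
  conv M K a (fun y => cos (l%:R * y + phi)) x = a l * cos (l%:R * x + phi).
Proof.
move=> KM lK; rewrite /conv.
rewrite (@eq_avg _ _ (fun y => \sum_(k < K) cweight k * a k *
    (cos (k%:R * y + - (k%:R * x)) * cos (l%:R * y + phi)))); last first.
  move=> y; rewrite big_distrl/=; apply: eq_bigr => k _.
  rewrite -mulrA; congr (_ * (_ * _)); rewrite -cosN; congr cos; ring.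
rewrite avg_sum (bigD1 (Ordinal lK))//= big1 ?addr0; last first.
  move=> k; rewrite -val_eqE/= => kl; rewrite avgZ (avg_cos_cos _ _ KM)//.
  by rewrite (negPf kl) mul0r mulr0.
rewrite avgZ (avg_cos_cos _ _ KM)// eqxx mul1r /cweight.
case: eqP => [->|_]; first by rewrite !mul0r oppr0 cos0 add0r; ring.
by rewrite -opprD cosN; field.
Qed.

Lemma conv_conv M K a b h x : (2 * K <= M)%N ->
  conv M K a (conv M K b h) x = conv M K (fun k => a k * b k) h x.
Proof.
move=> KM.
rewrite (@eq_conv _ _ _ a _ (fun z => \sum_(y <- nodes M) (M%:R^-1 * h y) *
    kern K b (z - y)))//; last first.
  move=> z; rewrite /conv /avg big_distrr/=; apply: eq_bigr => y _; ring.
rewrite conv_sum /conv /avg big_distrr/=; apply: eq_bigr => y _.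
rewrite -mulrA; congr (_ * _); rewrite mulrC; congr (_ * _).
rewrite -/(avg M (fun z => kern K a (x - z) * kern K b (z - y))).
rewrite -/(conv M K a (fun z => kern K b (z - y)) x).
rewrite (@eq_conv _ _ _ a _ (fun z => \sum_(k <- index_enum 'I_K) (cweight k * b k) *
    cos (k%:R * z + - (k%:R * y))))//; last first.
  by move=> z; apply: eq_bigr => k _; rewrite mulrBr.
rewrite conv_sum; apply: eq_bigr => k _.
rewrite (conv_cos _ _ _ KM)// -mulrBr; ring.
Qed.

Lemma conv_adj M K a h g :
  avg M (fun x => g x * conv M K a h x) = avg M (fun x => conv M K a g x * h x).
Proof.
rewrite (@eq_avg _ _ (fun x => avg M (fun y => g x * (kern K a (x - y) * h y)))).
  rewrite exchange_avg; apply: eq_avg => y; rewrite [RHS]mulrC -avgZ.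
  by apply: eq_avg => x; rewrite -[x - y]opprB kernN; ring.
by move=> x; rewrite avgZ.
Qed.

(** Convolution is self-adjoint and symbols multiply under composition, so the left side is the
    quadratic form of the symbol [b], the sum of the [a i ^ 2]. Since [b <= 1], it lies below the
    form of the projection onto degrees less than [K]. *)
Lemma bessel M K (I : Type) (r : seq I) (a : I -> nat -> R) h :
  (2 * K <= M)%N -> (forall k, (k < K)%N -> \sum_(i <- r) a i k ^+ 2 <= 1) ->
  \sum_(i <- r) avg M (fun x => conv M K (a i) h x ^+ 2) <= avg M (fun x => h x ^+ 2).
Proof.
move=> KM a1.
have sq c : avg M (fun x => conv M K c h x ^+ 2) =
    avg M (fun x => h x * conv M K (fun k => c k ^+ 2) h x).
  by rewrite (eq_avg _ (fun x => erefl _ : _ = _ * _)) -conv_adj; apply: eq_avg => x;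
    rewrite conv_conv.
pose b k := \sum_(i <- r) 1 * a i k ^+ 2.
have b1 k : (k < K)%N -> b k <= 1.
  move=> /a1; rewrite (_ : b k = \sum_(i <- r) a i k ^+ 2)//.
  by apply: eq_bigr => i _; rewrite mul1r.
rewrite (_ : \sum_(i <- r) _ = avg M (fun x => h x * conv M K b h x)); last first.
  rewrite (eq_bigr _ (fun i _ => sq (a i))) -avg_sum; apply: eq_avg => x.
  rewrite conv_symbol_sum -big_distrr; congr (_ * _).
  by apply: eq_bigr => i _; rewrite mul1r.
(* Nonnegativity of the form with symbol [1 - b], written as a square. *)
have := avg_ge0 M (fun x => sqr_ge0 (conv M K (fun k => Num.sqrt (1 - b k)) h x)).
rewrite sq (@eq_avg _ _ (fun x => h x * conv M K (fun=> 1) h x +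
    (- 1) * (h x * conv M K b h x))); last first.
  move=> x; rewrite [- 1 * _]mulrCA -mulrDr; congr (_ * _).
  have := conv_symbol_sum M K [:: true; false] (fun c => if c then 1 else - 1)
    (fun c => if c then fun=> 1 else b) h x.
  rewrite !big_cons !big_nil !addr0 mul1r => <-.
  apply: eq_conv => // k kK; rewrite !big_cons !big_nil.
  by rewrite sqr_sqrtr ?subr_ge0 ?b1//; ring.
rewrite avgD avgZ mulN1r subr_ge0 => /le_trans; apply.
(* The symbol [1] gives a projection only, as [h] is arbitrary; its form is at most the mean of
   [h ^ 2] because the residual has a nonnegative square. *)
have := avg_ge0 M (fun x => sqr_ge0 (h x - conv M K (fun=> 1) h x)).
rewrite (@eq_avg _ _ (fun x => h x ^+ 2 + ((- 2) * (h x * conv M K (fun=> 1) h x)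
    + conv M K (fun=> 1) h x ^+ 2))); last by move=> x; ring.
rewrite !avgD avgZ sq (@eq_avg _ (fun x => h x * conv M K (fun=> 1 ^+ 2) h x)
  (fun x => h x * conv M K (fun=> 1) h x)); last first.
  by move=> x; congr (_ * _); apply: eq_conv => // k _; rewrite expr1n.
lra.
Qed.

End Averages.

(** * Chebyshev and Jensen inequalities for weighted sums *)

(** Twice the difference of the two sides is the sum over pairs of [w i * w j * (y i - y j) * (y i ^
    n - y j ^ n)], and the last two factors have the same sign. *)
Lemma chebyshev_sum (R : realDomainType) (I : Type) (s : seq I) (w y : I -> R) n :
  (forall i, 0 <= w i) -> (forall i, 0 <= y i) ->
  (\sum_(i <- s) w i * y i) * (\sum_(i <- s) w i * y i ^+ n) <=
  (\sum_(i <- s) w i) * \sum_(i <- s) w i * y i ^+ n.+1.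
Proof.
move=> w0 y0; pose m a := \sum_(i <- s) w i * y i ^+ a.
rewrite (_ : \sum_(i <- s) w i = m 0%N); last first.
  by apply: eq_bigr => i _; rewrite expr0 mulr1.
rewrite -[X in X * _ <= _]/(m 1%N) -/(m n) -/(m n.+1).
have E a b : m a * m b = \sum_(i <- s) \sum_(j <- s) w i * w j * (y i ^+ a * y j ^+ b).
  rewrite big_distrl/=; apply: eq_bigr => i _.
  by rewrite big_distrr/=; apply: eq_bigr => j _; ring.
have : 0 <= m 0%N * m n.+1 + m n.+1 * m 0%N - (m 1%N * m n + m n * m 1%N).
  rewrite !E -!big_split -sumrB/= sumr_ge0// => i _.
  rewrite -!big_split -sumrB/= sumr_ge0// => j _.
  rewrite !expr0 !expr1 !exprS (_ : _ - _ =
    w i * w j * ((y i - y j) * (y i ^+ n - y j ^+ n))); last by ring.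
  apply: mulr_ge0; first exact: mulr_ge0.
  have [ij|/ltW ij] := leP (y i) (y j).
    by apply: mulr_le0; rewrite subr_le0// lerXn2r// nnegrE.
  by apply: mulr_ge0; rewrite subr_ge0// lerXn2r// nnegrE.
rewrite [m n.+1 * _]mulrC [m n * _]mulrC; lra.
Qed.

(** Induction on the exponent, each step being [chebyshev_sum]. Leaving the weights unnormalized
    avoids dividing by their sum. *)
Lemma jensen_sum (R : realDomainType) (I : Type) (s : seq I) (w y : I -> R) n :
  (forall i, 0 <= w i) -> (forall i, 0 <= y i) ->
  (\sum_(i <- s) w i * y i) ^+ n.+1 <=
  (\sum_(i <- s) w i) ^+ n * \sum_(i <- s) w i * y i ^+ n.+1.
Proof.
move=> w0 y0; elim: n => [|n IH]; first by rewrite expr0 mul1r expr1.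
rewrite exprS (le_trans (ler_wpM2l _ IH))//.
  by rewrite sumr_ge0// => i _; rewrite mulr_ge0.
rewrite mulrCA exprSr -mulrA ler_wpM2l ?exprn_ge0 ?sumr_ge0//.
exact: chebyshev_sum.
Qed.

(** * Fejer and de la Vallee-Poussin kernels, and the dyadic blocks *)

Section DyadicBlocks.
Variable R : realType.
Implicit Types (M K k l n s : nat) (h g : R -> R) (x y t : R).

Definition fejer n k : R := (n - k)%:R / n%:R.

(** The right side is the squared modulus of the sum of [e^(ijt)] over [j < n], in which each
    difference [k] arises from [n - k] pairs. *)
Lemma fejer_square n t :
  \sum_(k < n) cweight R k * (n - k)%:R * cos (k%:R * t) =
  (\sum_(j < n) cos (j%:R * t)) ^+ 2 + (\sum_(j < n) sin (j%:R * t)) ^+ 2.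
Proof.
elim: n => [|n IH]; first by rewrite !big_ord0 expr0n addr0.
rewrite [X in X ^+ 2 + _]big_ord_recr [X in _ + X ^+ 2]big_ord_recr/=.
set C := \sum_(j < n) cos _ in IH *; set S := \sum_(j < n) sin _ in IH *.
transitivity (C ^+ 2 + S ^+ 2 + (1 + 2 * (C * cos (n%:R * t) + S * sin (n%:R * t)))).
  rewrite -IH (eq_bigr (fun k : 'I_n.+1 => cweight R k * (n - k)%:R * cos (k%:R * t) +
      cweight R k * cos (k%:R * t))); last first.
    by move=> k _; rewrite subSn -1?ltnS// -natr1; ring.
  rewrite big_split/= big_ord_recr/= subnn mulr0 mul0r addr0; congr (_ + _).
  rewrite big_ord_recl/= /cweight/= mul0r cos0 mulr1; congr (_ + _).
  rewrite /C /S !big_distrl -big_split/= big_distrr/= (reindex_inj rev_ord_inj)/=.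
  apply: eq_bigr => j _; rewrite -cosB -[cos (_ - _)]cosN opprB -mulrBl.
  by rewrite -natrB ?(ltnW (ltn_ord j))// /bump leq0n add1n subnSK.
have := cos2Dsin2 (n%:R * t); lra.
Qed.

Lemma kern_fejer K n t : (0 < n <= K)%N ->
  kern K (fejer n) t = n%:R^-1 *
  ((\sum_(j < n) cos (j%:R * t)) ^+ 2 + (\sum_(j < n) sin (j%:R * t)) ^+ 2).
Proof.
case/andP=> n0 nK; rewrite -fejer_square /kern (big_ord_widen_cond _ xpredT
  (fun k => cweight R k * (n - k)%:R * cos (k%:R * t)) nK).
rewrite big_distrr/= [LHS](bigID (fun k : 'I_K => k < n)%N)/= [X in _ + X]big1.
  by rewrite addr0; apply: eq_bigr => k _; rewrite /fejer; ring.
by move=> k; rewrite -leqNgt /fejer -subn_eq0 => /eqP ->; rewrite mul0r mulr0 mul0r.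
Qed.

Lemma kern_fejer_ge0 K n t : (0 < n <= K)%N -> 0 <= kern K (fejer n) t.
Proof. by move=> nK; rewrite kern_fejer// mulr_ge0 ?invr_ge0// addr_ge0// sqr_ge0. Qed.

Lemma kern_fejer_le K n t : (0 < n <= K)%N -> kern K (fejer n) t <= 2 * n%:R.
Proof.
move=> nK; rewrite kern_fejer//.
have S (f : R -> R) : (forall x, `|f x| <= 1) ->
    (\sum_(j < n) f (j%:R * t)) ^+ 2 <= n%:R ^+ 2.
  move=> f1; rewrite -real_normK ?num_real// lerXn2r ?nnegrE//.
  rewrite (le_trans (ler_norm_sum _ _ _))//.
  by rewrite -[n in n%:R]card_ord -sum1_card natr_sum ler_sum.
have n0 : 0 < n%:R :> R by rewrite ltr0n; case/andP: nK.
rewrite ler_pdivrMl// (_ : _ * _ = n%:R ^+ 2 + n%:R ^+ 2); last by ring.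
by rewrite lerD// S// => x; [exact: cos_max|exact: sin_max].
Qed.

Lemma avg_kern M K (a : nat -> R) x : (0 < K)%N -> (2 * K <= M)%N ->
  avg M (fun y => kern K a (x - y)) = a 0%N.
Proof.
move=> K0 KM; have := conv_cos a 0 x KM K0; rewrite mul0r addr0 cos0 mulr1 => <-.
by apply: eq_avg => y; rewrite mul0r addr0 cos0 mulr1.
Qed.

(** This combination of two Fejer symbols is 1 up to [2 ^ s] and 0 from [2 ^ s.+1] on, while the
    mean absolute value of its kernel is at most [2 + 1] for every [s]; a sharp cutoff would cost a
    logarithm. *)
Definition vallee s k : R := 2 * fejer (2 ^ s.+1) k - fejer (2 ^ s) k.

Lemma vallee1 s k : (k <= 2 ^ s)%N -> vallee s k = 1.
Proof.
move=> ks; rewrite /vallee /fejer !natrB// ?expnS; last by lia.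
rewrite natrM; have : (2 ^ s)%:R != 0 :> R by rewrite pnatr_eq0 expn_eq0.
by move=> e; field.
Qed.

Lemma vallee0 s k : (2 ^ s.+1 <= k)%N -> vallee s k = 0.
Proof.
move=> ks; rewrite /vallee /fejer (_ : _ - k = 0)%N; last lia.
rewrite expnS in ks; rewrite (_ : _ - k = 0)%N; last lia.
by rewrite !mul0r mulr0 subr0.
Qed.

Lemma vallee_itv s k : 0 <= vallee s k <= 1.
Proof.
have [/vallee1->|ks] := leqP k (2 ^ s); first by rewrite ler01 lexx.
have [/vallee0->|ks'] := leqP (2 ^ s.+1) k; first by rewrite ler01 lexx.
rewrite /vallee /fejer (_ : 2 ^ s - k = 0)%N ?mul0r ?subr0; last lia.
rewrite expnS in ks' *.
have s0 : 0 < (2 ^ s)%:R :> R by rewrite ltr0n expn_gt0.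
rewrite !mulr_ge0 ?invr_ge0//= mulrA ler_pdivrMr ?natrM ?mulr_gt0// mul1r.
by rewrite ler_pM2l// ler_nat; lia.
Qed.

Lemma vallee_le s k : vallee s k <= vallee s.+1 k.
Proof.
have /andP[v0 v1] := vallee_itv s k; have /andP[w0 w1] := vallee_itv s.+1 k.
have [/vallee1->//|/ltnW/vallee0->//] := leqP k (2 ^ s.+1).
Qed.

Definition block s k : R := if s is s'.+1 then vallee s k - vallee s' k else vallee 0 k.

Lemma block_ge0 s k : 0 <= block s k.
Proof. by case: s => [|s]/=; [case/andP: (vallee_itv 0 k)|rewrite subr_ge0 vallee_le]. Qed.

Lemma sum_block L k : \sum_(s < L.+1) block s k = vallee L k.
Proof.
elim: L => [|L IH]; first by rewrite big_ord1.
by rewrite big_ord_recr/= IH addrC subrK.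
Qed.

(** Each symbol lies between 0 and 1, so its square is below the symbol itself, and the symbols
    telescope. This is the hypothesis of [bessel]. *)
Lemma sum_block_sqr L k : \sum_(s < L) block s k ^+ 2 <= 1.
Proof.
case: L => [|L]; first by rewrite big_ord0.
apply: (@le_trans _ _ (vallee L k)); last by case/andP: (vallee_itv L k).
rewrite -sum_block ler_sum// => s _; rewrite expr2 ler_piMr ?block_ge0//.
case: (s : nat) => [|s']/=; first by case/andP: (vallee_itv 0 k).
have := vallee_itv s'.+1 k; have := vallee_itv s' k; lra.
Qed.

(** The block [s] is supported below [2 ^ s.+1], where [vallee s.+1] is 1. Hence a block function is
    reproduced by a kernel of height of order [2 ^ s]. *)
Lemma vallee_block s k : vallee s.+1 k * block s k = block s k.
Proof.
have [/vallee1->|ks] := leqP k (2 ^ s.+1); first by rewrite mul1r.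
have v0 : vallee s k = 0 by rewrite vallee0// ltnW.
case: s v0 ks => [|s]/= -> ks; first by rewrite mulr0.
by rewrite [vallee s k]vallee0 ?subrr ?mulr0// (leq_trans _ (ltnW ks))// leq_exp2l.
Qed.

(** Low frequencies cancel in the difference of two [vallee] symbols. This bounds the indices that
    can occur for a frequency of the cross. *)
Lemma block_neq0 s k : block s k != 0 -> (2 ^ s <= 2 * maxn 1 k)%N.
Proof.
case: s => [|s]/=; first by rewrite expn0; lia.
rewrite expnS leq_mul2l/=; case: (leqP k (2 ^ s)) => [ks|]; last by lia.
by rewrite !vallee1 ?subrr ?eqxx// (leq_trans ks)// leq_exp2l.
Qed.

Lemma kern_vallee K s t :
  kern K (vallee s) t = 2 * kern K (fejer (2 ^ s.+1)) t - kern K (fejer (2 ^ s)) t.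
Proof.
by rewrite /kern big_distrr -sumrB; apply: eq_bigr => k _; rewrite /vallee/=; ring.
Qed.

Let exp2_itv K s : (2 ^ s.+1 <= K)%N -> (0 < 2 ^ s.+1 <= K)%N /\ (0 < 2 ^ s <= K)%N.
Proof. by move=> sK; rewrite !expn_gt0/= sK; split => //; rewrite expnS in sK; lia. Qed.

Lemma norm_kern_vallee_le K s t : (2 ^ s.+1 <= K)%N ->
  `|kern K (vallee s) t| <= 10 * 2 ^+ s.
Proof.
move=> /exp2_itv[sK sK']; rewrite kern_vallee (le_trans (ler_normB _ _))//.
rewrite normrM !ger0_norm ?kern_fejer_ge0//.
have := kern_fejer_le t sK; have := kern_fejer_le t sK'.
rewrite expnS natrM natrX; lra.
Qed.

Lemma avg_norm_kern_vallee M K s x : (2 ^ s.+1 <= K)%N -> (2 * K <= M)%N ->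
  avg M (fun y => `|kern K (vallee s) (x - y)|) <= 3.
Proof.
move=> /exp2_itv[sK sK'] KM.
have K0 : (0 < K)%N by case/andP: sK => ? /(leq_trans _); exact.
apply: (@le_trans _ _ (avg M (fun y => 2 * kern K (fejer (2 ^ s.+1)) (x - y) +
    kern K (fejer (2 ^ s)) (x - y)))).
  apply: le_avg => y; rewrite kern_vallee (le_trans (ler_normB _ _))//.
  by rewrite normrM !ger0_norm ?kern_fejer_ge0.
have f1 n : (0 < n)%N -> fejer n 0 = 1.
  by move=> n0; rewrite /fejer subn0 divff// pnatr_eq0 -lt0n.
by rewrite avgD avgZ !avg_kern// !f1 ?expn_gt0//; lra.
Qed.

Lemma norm_conv_vallee_le M K s h (B : R) x : (2 ^ s.+1 <= K)%N -> (2 * K <= M)%N ->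
  (forall y, `|h y| <= B) -> `|conv M K (vallee s) h x| <= 3 * B.
Proof.
move=> sK KM hB; rewrite (le_trans (ler_norm_avg _ _))//.
apply: (@le_trans _ _ (avg M (fun y => B * `|kern K (vallee s) (x - y)|))).
  by apply: le_avg => y; rewrite normrM mulrC ler_wpM2r.
rewrite avgZ mulrC ler_wpM2r ?avg_norm_kern_vallee//.
by rewrite (le_trans _ (hB 0)).
Qed.

Lemma norm_conv_block_le M K s h (B : R) x : (2 ^ s.+1 <= K)%N -> (2 * K <= M)%N ->
  (forall y, `|h y| <= B) -> `|conv M K (block s) h x| <= 6 * B.
Proof.
move=> sK KM hB; case: s sK => [|s] sK.
  have := norm_conv_vallee_le x sK KM hB; have := le_trans (normr_ge0 _) (hB 0).
  rewrite /block; lra.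
have sK' : (2 ^ s.+1 <= K)%N by rewrite expnS in sK; lia.
have -> : conv M K (block s.+1) h x = conv M K (vallee s.+1) h x - conv M K (vallee s) h x.
  have := conv_symbol_sum M K [:: true; false] (fun c => if c then 1 else - 1)
    (fun c => vallee (s + c)) h x.
  rewrite !big_cons !big_nil !addr0 mul1r mulN1r addn1 addn0 => <-.
  by apply: eq_conv => // k _; rewrite !big_cons !big_nil addn1 addn0/=; ring.
rewrite (le_trans (ler_normB _ _))//.
by have := norm_conv_vallee_le x sK KM hB; have := norm_conv_vallee_le x sK' KM hB; lra.
Qed.

(** The block is reproduced by the kernel of [vallee s.+1], and Jensen is applied with the absolute
    value of that kernel as weight: its mass is at most 3 and its height at most
    [10 * 2 ^+ s.+1]. *)
Lemma conv_block_exp_le M K s h n x : (2 ^ s.+2 <= K)%N -> (2 * K <= M)%N ->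
  `|conv M K (block s) h x| ^+ n.+1 <=
  20 * 3 ^+ n * 2 ^+ s * avg M (fun y => `|conv M K (block s) h y| ^+ n.+1).
Proof.
move=> sK KM; set g := conv M K (block s) h.
have -> : g x = conv M K (vallee s.+1) g x.
  rewrite conv_conv//; apply: eq_conv => // k _; rewrite vallee_block//.
have w0 y : 0 <= M%:R^-1 * `|kern K (vallee s.+1) (x - y)| by rewrite mulr_ge0 ?invr_ge0.
apply: (@le_trans _ _ ((\sum_(y <- nodes R M)
    (M%:R^-1 * `|kern K (vallee s.+1) (x - y)|) * `|g y|) ^+ n.+1)).
  rewrite lerXn2r ?nnegrE//; first by rewrite sumr_ge0// => y _; rewrite mulr_ge0.
  rewrite (le_trans (ler_norm_avg _ _))// /avg big_distrr/= ler_sum// => y _.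
  by rewrite normrM mulrA.
rewrite (le_trans (jensen_sum _ _ _ _))//.
rewrite (_ : 20 * 3 ^+ n * 2 ^+ s = 3 ^+ n * (10 * 2 ^+ s.+1)); last by rewrite exprS; ring.
rewrite -mulrA ler_pM//.
- by rewrite exprn_ge0// sumr_ge0.
- by rewrite sumr_ge0// => y _; rewrite mulr_ge0 ?exprn_ge0.
- rewrite lerXn2r ?nnegrE ?sumr_ge0// -big_distrr/=.
  exact: avg_norm_kern_vallee.
- rewrite -avgZ /avg big_distrr/= ler_sum// => y _; rewrite -[leLHS]mulrA ler_wpM2l ?invr_ge0//.
  by rewrite ler_wpM2r ?exprn_ge0// norm_kern_vallee_le.
Qed.

End DyadicBlocks.

(** * Elementary estimates: geometric series, sums over pairs, and interpolation *)

Lemma le_div_nat (R : realType) (a b D : R) :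
  (forall n, (0 < n)%N -> a <= b + D / n%:R) -> a <= b.
Proof.
move=> abD; apply/ler_addgt0Pr => e e0.
have [D0|D0] := leP D 0.
  have := abD 1%N isT; rewrite divr1; lra.
apply: (le_trans (abD (Num.truncn (D / e)).+1 isT)).
rewrite lerD2l ler_pdivrMr// mulrC -ler_pdivrMr// ltW//.
exact: truncnS_gt.
Qed.

Lemma max_seq (R : realDomainType) (I : eqType) (s : seq I) (a : I -> R) :
  s != [::] -> exists2 t, t \in s & forall i, i \in s -> a i <= a t.
Proof.
elim: s => // x [|y s] IH _.
  by exists x; rewrite ?mem_head// => i; rewrite inE => /eqP->.
have [//|t ts tmax] := IH; have [xt|/ltW tx] := leP (a x) (a t).
  by exists t; [rewrite inE ts orbT|move=> i; rewrite inE => /predU1P[->//|/tmax]].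
exists x; rewrite ?mem_head// => i; rewrite inE => /predU1P[->//|/tmax].
by move/le_trans; exact.
Qed.

Section GeometricSums.
Variable R : realType.

Lemma sum_geometric_le (x : R) n : 0 <= x < 1 -> \sum_(i < n) x ^+ i <= (1 - x)^-1.
Proof.
case/andP=> x0 x1; have x1' : 0 < 1 - x by rewrite subr_gt0.
rewrite -(ler_pM2l x1') mulfV ?gt_eqF//.
by have := subrX1 x n; have := exprn_ge0 n x0; lra.
Qed.

(** With truncated subtraction the exponent is [|i - t|], so there is one geometric series on each
    side of [t]. *)
Lemma sum_geometric_distn_le (x : R) n t : 0 <= x < 1 ->
  \sum_(i < n) x ^+ ((i - t) + (t - i))%N <= 2 * (1 - x)^-1.
Proof.
move=> x01; have /andP[x0 _] := x01.
suff H : \sum_(i < n) x ^+ ((i - t) + (t - i))%N <= (1 - x)^-1 + \sum_(j < t.+1) x ^+ j.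
  by have := sum_geometric_le t.+1 x01; lra.
elim: t n => [|t IH] n.
  apply: (@le_trans _ _ (1 - x)^-1); last by rewrite lerDl sumr_ge0// => i _; exact: exprn_ge0.
  rewrite (eq_bigr (fun i : 'I_n => x ^+ i)) ?sum_geometric_le// => i _.
  by rewrite sub0n subn0 addn0.
case: n => [|n].
  by rewrite big_ord0 addr_ge0 ?sumr_ge0// => [|i _]; [rewrite invr_ge0; lra|exact: exprn_ge0].
rewrite big_ord_recl [X in _ <= _ + X]big_ord_recr/= sub0n subn0 add0n.
by rewrite addrA addrC lerD2l (le_trans _ (IH n))// ler_sum.
Qed.

(** The heights [L / 2 ^+ k] that pass the test form a geometric progression whose first term is at
    most [Num.min L z]; the positive power keeps the ratio at most one half. *)
Lemma sum_dyadic_below_le (p J : nat) (L z : R) : 0 < L -> 0 <= z ->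
  \sum_(k < J) (if L / 2 ^+ k < z then (L / 2 ^+ k) ^+ p.+1 else 0) <=
  2 * Num.min L z ^+ p.+1.
Proof.
elim: J L => [|J IH] L L0 z0.
  by rewrite big_ord0 mulr_ge0// exprn_ge0// le_min z0 ltW.
rewrite big_ord_recl expr0 divr1.
rewrite (eq_bigr (fun k : 'I_J => if (L / 2) / 2 ^+ k < z then ((L / 2) / 2 ^+ k) ^+ p.+1 else 0)); last first.
  by move=> k _; rewrite /= [2 ^+ (bump 0 k)]exprS invfM mulrA.
have L20 : 0 < L / 2 by rewrite divr_gt0.
have {}IH := IH _ L20 z0.
case: ifPn => [Lz|]; last rewrite -leNgt => zL.
  rewrite min_l ?(ltW Lz)//; rewrite min_l in IH; last by lra.
  rewrite (le_trans (lerD (lexx _) IH))// expr_div_n.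
  have Lp : 0 < L ^+ p.+1 by rewrite exprn_gt0.
  have : (2 ^+ p.+1)^-1 <= 2^-1 :> R.
    by rewrite lef_pV2 ?posrE ?exprn_gt0// ler_eXnr// ler1n.
  by rewrite -(ler_pM2l Lp); lra.
rewrite add0r (le_trans IH)// ler_pM2l// [X in _ <= X ^+ _]min_r//.
by rewrite lerXn2r ?nnegrE// ?le_min ?z0 ?(ltW L20)// ge_min lexx orbT.
Qed.

End GeometricSums.

(* One factor [a t] is extracted at the largest term [t], and the other terms are
   summed against the weights centred at [t]. *)
Lemma sum_exp_le_pairs (R : realFieldType) (I : eqType) (s : seq I) (a : I -> R)
    (w : I -> I -> R) (A : R) n :
  (forall i, 0 <= a i) -> (forall i j, 0 < w i j) ->
  (forall j, j \in s -> \sum_(i <- s) (w i j)^-1 <= A) ->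
  (\sum_(i <- s) a i) ^+ (2 * n.+1) <=
  A ^+ (n.+1 + n) * \sum_(i <- s) \sum_(j <- s) w i j ^+ (2 * n).+1 * (a i ^+ n.+1 * a j ^+ n.+1).
Proof.
move=> a0 w0 wA; case: (eqVneq s [::]) => [->|s0].
  by rewrite !big_nil mulr0 expr0n.
have [t ts tmax] := max_seq a s0.
have wi0 i j : 0 <= (w i j)^-1 by rewrite invr_ge0 ltW.
have A0 : 0 <= A by rewrite (le_trans _ (wA t ts))// sumr_ge0.
pose b := \sum_(i <- s) w i t * a i.
have b0 : 0 <= b by rewrite sumr_ge0// => i _; rewrite mulr_ge0// ltW.
have wK i : (w i t)^-1 * (w i t * a i) = a i.
  by rewrite mulKf// gt_eqF.
(* Cauchy-Schwarz with weights [(w i t)^-1], after which one of the two factors [a i] is replaced by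
   the maximum [a t]. *)
have S2 : (\sum_(i <- s) a i) ^+ 2 <= A * (a t * b).
  have := @jensen_sum _ _ s (fun i => (w i t)^-1) (fun i => w i t * a i) 1
    (fun i => wi0 i t) (fun i => mulr_ge0 (ltW (w0 i t)) (a0 i)).
  rewrite (eq_bigr _ (fun i _ => wK i)) expr1 => /le_trans; apply.
  apply: ler_pM; rewrite ?sumr_ge0// ?wA//.
    by move=> i _; rewrite mulr_ge0// exprn_ge0// mulr_ge0// ltW.
  rewrite big_distrr/= big_seq [leRHS]big_seq ler_sum// => i si.
  by rewrite expr2 mulrA wK ler_wpM2r ?tmax// mulr_ge0 ?(ltW (w0 i t)).
(* Jensen for [w i t * a i = (w i t)^-1 * (w i t ^+ 2 * a i)]; the weight ends with the power
   [2 * n.+1 - 1]. *)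
have bn : b ^+ n.+1 <= A ^+ n * \sum_(i <- s) w i t ^+ (2 * n).+1 * a i ^+ n.+1.
  have := @jensen_sum _ _ s (fun i => (w i t)^-1) (fun i => w i t ^+ 2 * a i) n
    (fun i => wi0 i t) (fun i => mulr_ge0 (exprn_ge0 2 (ltW (w0 i t))) (a0 i)).
  rewrite (_ : \sum_(i <- s) _ * (_ * a i) = b); last first.
    by apply: eq_bigr => i _; rewrite expr2 -mulrA mulKf// gt_eqF.
  move=> /le_trans; apply; apply: ler_pM.
  - by rewrite exprn_ge0// sumr_ge0.
  - by rewrite sumr_ge0// => i _; rewrite mulr_ge0// exprn_ge0// mulr_ge0// exprn_ge0// ltW.
  - by rewrite lerXn2r ?nnegrE ?sumr_ge0 ?wA.
  - rewrite ler_sum// => i _; rewrite exprMn -exprM mulrA mulnS add2n.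
    by rewrite [w i t ^+ _.+2]exprS mulKf ?lexx// gt_eqF.
rewrite exprM (le_trans (lerXn2r _ _ _ S2)) ?nnegrE ?exprn_ge0 ?sumr_ge0 ?mulr_ge0//.
rewrite !exprMn exprD -mulrA ler_wpM2l ?exprn_ge0//.
rewrite (le_trans (ler_wpM2l (exprn_ge0 _ (a0 t)) bn))// mulrCA ler_wpM2l ?exprn_ge0//.
(* Of the double sum only the terms with second index [t] are kept. *)
rewrite exchange_big/= [leRHS](big_rem t ts)/= -[leLHS]addr0 lerD//.
  rewrite big_distrr/= ler_sum// => i _; rewrite mulrCA [a t ^+ _ * _]mulrC.
  by rewrite lexx.
rewrite sumr_ge0// => i _; rewrite sumr_ge0// => j _.
by rewrite mulr_ge0 ?mulr_ge0 ?exprn_ge0// ltW.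
Qed.

(* Marcinkiewicz interpolation, by truncating [u] at dyadic heights. *)
Lemma sum_exp_interpolation (R : realType) (X : eqType) (I : eqType) (pts : seq X)
    (S : seq I) (T : I -> (X -> R) -> X -> R) (C : R) (p : nat) (u : X -> R) :
  0 < C ->
  (forall i v w x, T i (fun y => v y + w y) x = T i v x + T i w x) ->
  (forall i v B x, i \in S -> x \in pts -> (forall y, `|v y| <= B) -> `|T i v x| <= C * B) ->
  (forall v, \sum_(i <- S) \sum_(x <- pts) T i v x ^+ 2 <= \sum_(x <- pts) v x ^+ 2) ->
  \sum_(i <- S) \sum_(x <- pts) `|T i u x| ^+ p.+3 <=
  8 * (4 * C) ^+ p.+1 * \sum_(x <- pts) `|u x| ^+ p.+3.
Proof.
move=> C0 Tadd Tbnd Tsq.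
(* The top height dominates every value of [T i u]; the summand 1 makes it positive. *)
pose L : R := 1 + \sum_(i <- S) \sum_(x <- pts) `|T i u x|.
have SS0 : 0 <= \sum_(i <- S) \sum_(x <- pts) `|T i u x|.
  by rewrite sumr_ge0// => i _; rewrite sumr_ge0.
have L0 : 0 < L by rewrite /L; lra.
have TL i x : i \in S -> x \in pts -> `|T i u x| <= L.
  move=> iS xp; rewrite /L (big_rem i iS)/= (big_rem x xp)/=.
  rewrite addrCA -addrA lerDl addr_ge0 ?addr_ge0 ?sumr_ge0//.
  by move=> j _; rewrite sumr_ge0.
pose l k : R := L / 2 ^+ k.
have l0 k : 0 < l k by rewrite divr_gt0// exprn_gt0.
have lS k : l k = 2 * l k.+1.
  by rewrite /l exprS invfM mulrCA [2 * _]mulrA divff// mul1r.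
(* Cutting [u] at [l k.+1 / (2 * C)] makes [T i] of the low part at most [l k.+1 / 2], by the
   uniform bound. *)
pose hi k x : R := if l k.+1 < 2 * C * `|u x| then u x else 0.
pose lo k x : R := if l k.+1 < 2 * C * `|u x| then 0 else u x.
have hilo k : u = (fun x => hi k x + lo k x).
  by apply/funext => x; rewrite /hi /lo; case: ifP; rewrite ?addr0 ?add0r.
have loB k x : `|lo k x| <= l k.+1 / (2 * C).
  rewrite /lo; case: ifPn => [_|]; first by rewrite normr0 ltW// divr_gt0// mulr_gt0.
  by rewrite -leNgt => ul; rewrite ler_pdivlMr ?mulr_gt0// mulrC.
(* When [|T i u x|] lies between [l k.+1] and [l k], the low part gives at most half of it. Two of
   the [p.+3] factors are then bounded by [2 * |T i (hi k) x|] and the others by [l k]. *)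
have term i x J : i \in S -> x \in pts -> l J < `|T i u x| ->
    `|T i u x| ^+ p.+3 <= \sum_(k < J) 4 * l k ^+ p.+1 * T i (hi k) x ^+ 2.
  move=> iS xp; elim: J => [|J IH].
    by rewrite /l expr0 divr1 ltNge TL.
  have t0 : 0 <= 4 * l J ^+ p.+1 * T i (hi J) x ^+ 2.
    by rewrite mulr_ge0 ?sqr_ge0// mulr_ge0// exprn_ge0// ltW.
  move=> lJ; rewrite big_ord_recr/=; have [yl|/IH] := leP `|T i u x| (l J); last by lra.
  rewrite -[leLHS]add0r lerD//.
    by rewrite sumr_ge0// => k _; rewrite mulr_ge0 ?sqr_ge0// mulr_ge0// exprn_ge0// ltW.
  have y2 : `|T i u x| <= 2 * `|T i (hi J) x|.
    have : `|T i (lo J) x| <= l J.+1 / 2.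
      rewrite (le_trans (Tbnd _ _ _ _ iS xp (loB J)))// le_eqVlt; apply/orP; left.
      by apply/eqP; field; rewrite gt_eqF.
    have : `|T i u x| <= `|T i (hi J) x| + `|T i (lo J) x|.
      by rewrite {1}(hilo J) Tadd ler_normD.
    lra.
  rewrite -addn2 exprD -[leRHS]mulrA [4 * _]mulrC -mulrA.
  rewrite (_ : T i (hi J) x ^+ 2 * 4 = (2 * `|T i (hi J) x|) ^+ 2); last first.
    by rewrite exprMn real_normK ?num_real//; ring.
  rewrite ler_pM ?exprn_ge0// lerXn2r ?nnegrE// ?mulr_ge0//.
  exact: ltW.
(* Values below the lowest height [l J] contribute at most [D / J], which disappears as [J]
   grows. *)
pose D := (size S)%:R * (size pts)%:R * L ^+ p.+3.
apply: (@le_div_nat _ _ _ D) => J J0.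
have termJ i x : i \in S -> x \in pts -> `|T i u x| ^+ p.+3 <=
    \sum_(k < J) 4 * l k ^+ p.+1 * T i (hi k) x ^+ 2 + l J ^+ p.+3.
  move=> iS xp; have [yl|/(term _ _ _ iS xp) h] := leP `|T i u x| (l J).
    rewrite -[leLHS]add0r lerD// ?lerXn2r ?nnegrE// ?(ltW (l0 _))//.
    by rewrite sumr_ge0// => k _; rewrite mulr_ge0 ?sqr_ge0// mulr_ge0// exprn_ge0// ltW.
  by rewrite (le_trans h)// lerDl exprn_ge0// ltW.
have lJ : l J ^+ p.+3 <= L ^+ p.+3 / J%:R.
  rewrite /l expr_div_n ler_pM2l ?exprn_gt0// lef_pV2 ?posrE ?exprn_gt0 ?ltr0n//.
  apply: (@le_trans _ _ (2 ^+ J)); last by rewrite ler_eXnr// exprn_ege1// ler1n.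
  by rewrite -natrX ler_nat ltnW// ltn_expl.
apply: (@le_trans _ _ (\sum_(i <- S) \sum_(x <- pts)
    (\sum_(k < J) 4 * l k ^+ p.+1 * T i (hi k) x ^+ 2 + L ^+ p.+3 / J%:R))).
  rewrite big_seq [leRHS]big_seq ler_sum// => i iS.
  rewrite big_seq [leRHS]big_seq ler_sum// => x xp.
  by rewrite (le_trans (termJ _ _ iS xp))// lerD2l.
under eq_bigr => i _ do rewrite big_split/=.
rewrite big_split/= lerD//; last first.
  rewrite !big_const_seq !count_predT !iter_addr_0 /D.
  by rewrite -[_ *+ size pts]mulr_natl -[_ *+ size S]mulr_natl !mulrA.
rewrite (_ : \sum_(i <- S) _ = \sum_(k < J) 4 * l k ^+ p.+1 *
    \sum_(i <- S) \sum_(x <- pts) T i (hi k) x ^+ 2); last first.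
  under eq_bigr do rewrite exchange_big/=.
  rewrite exchange_big/=; apply: eq_bigr => k _; rewrite big_distrr/=.
  by apply: eq_bigr => i _; rewrite big_distrr.
apply: (@le_trans _ _ (\sum_(k < J) 4 * l k ^+ p.+1 * \sum_(x <- pts) hi k x ^+ 2)).
  by rewrite ler_sum// => k _; rewrite ler_wpM2l// mulr_ge0// exprn_ge0// ltW.
rewrite (_ : \sum_(k < J) _ = \sum_(x <- pts) \sum_(k < J) 4 * l k ^+ p.+1 * hi k x ^+ 2);
  last by rewrite exchange_big/=; apply: eq_bigr => k _; rewrite big_distrr.
rewrite big_distrr/= ler_sum// => x _.
(* The test [l k.+1 < 2 * C * |u x|] in [hi] reads [l k < 4 * C * |u x|], so the heights to be
   summed are those of [sum_dyadic_below_le]. *)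
have z0 : 0 <= 4 * C * `|u x| by rewrite mulr_ge0// mulr_ge0// ltW.
have := sum_dyadic_below_le p J L0 z0.
have m0 : 0 <= Num.min L (4 * C * `|u x|) by rewrite le_min z0 ltW.
have : Num.min L (4 * C * `|u x|) ^+ p.+1 <= (4 * C * `|u x|) ^+ p.+1.
  by rewrite lerXn2r ?nnegrE// ge_min lexx orbT.
move=> /(ler_wpM2l (ler0n R 2)) h2 /le_trans/(_ h2).
have u2 : 0 <= 4 * u x ^+ 2 by rewrite mulr_ge0// sqr_ge0.
move=> /(ler_wpM2l u2) h; apply: (le_trans (le_trans _ h)); last first.
  rewrite le_eqVlt; apply/orP; left; apply/eqP.
  by rewrite !exprMn -(real_normK (num_real (u x))) !exprS; ring.
rewrite big_distrr/= ler_sum// => k _; rewrite /hi.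
case: ifPn => [lk|_]; last first.
  rewrite expr0n/= mulr0 mulr_ge0//; case: ifP => // _; apply: exprn_ge0; exact: ltW (l0 k).
rewrite -/(l k) (_ : l k < 4 * C * `|u x|); last by rewrite lS; lra.
by rewrite mulrAC.
Qed.

(** * Grid averages and tensor-product blocks in several variables *)

(** Used both for the grid points and for the multi-indices. Lists rather than tuples allow
    induction on the dimension by peeling off the first coordinate. *)
Fixpoint words (T : Type) (A : seq T) (d : nat) : seq (seq T) :=
  if d is d'.+1 then [seq a :: w | a <- A, w <- words A d'] else [:: [::]].

Lemma big_words (R : Type) (idx : R) (op : Monoid.law idx) (T : Type) (A : seq T) d
    (F : seq T -> R) :
  \big[op/idx]_(w <- words A d.+1) F w =
  \big[op/idx]_(a <- A) \big[op/idx]_(w <- words A d) F (a :: w).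
Proof. exact: big_allpairs_dep. Qed.

Lemma mem_words (T : eqType) (A : seq T) d w :
  (w \in words A d) = (size w == d) && all (mem A) w.
Proof.
elim: d w => [|d IH] [|a w] //=.
  by apply/negbTE/negP => /allpairsP[[? ?] [? ? ?]].
rewrite eqSS andbCA -IH; apply/allpairsP/andP => [[[b v] [/= ? ? [-> ->]]]//|[? ?]].
by exists (a, w).
Qed.

Section Grid.
Variable R : realType.
Implicit Types (M K d L : nat) (s t : seq nat) (x : seq R) (u U V : seq R -> R).

Definition gavg M d u : R := M%:R^-1 ^+ d * \sum_(x <- words (nodes R M) d) u x.

Lemma gavg0 M u : gavg M 0 u = u [::].
Proof. by rewrite /gavg big_seq1 expr0 mul1r. Qed.

Lemma gavgS M d u : gavg M d.+1 u = avg M (fun a => gavg M d (fun x => u (a :: x))).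
Proof.
rewrite /gavg big_words exprS -mulrA big_distrr/= /avg; congr (_ * _).
Qed.

Lemma le_gavg M d u U : (forall x, size x = d -> u x <= U x) -> gavg M d u <= gavg M d U.
Proof.
move=> uU; rewrite ler_wpM2l ?exprn_ge0 ?invr_ge0//.
rewrite big_seq [leRHS]big_seq ler_sum// => x.
by rewrite mem_words => /andP[/eqP/uU].
Qed.

Lemma gavg_ge0 M d u : (forall x, 0 <= u x) -> 0 <= gavg M d u.
Proof. by move=> u0; rewrite mulr_ge0 ?exprn_ge0 ?invr_ge0// sumr_ge0. Qed.

Lemma gavgZ M d c u : gavg M d (fun x => c * u x) = c * gavg M d u.
Proof. by rewrite /gavg -big_distrr/= mulrCA. Qed.

Lemma gavgD M d u U : gavg M d (fun x => u x + U x) = gavg M d u + gavg M d U.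
Proof. by rewrite /gavg big_split/= mulrDr. Qed.

Lemma gavg_sum M d (I : Type) (r : seq I) (F : I -> seq R -> R) :
  gavg M d (fun x => \sum_(i <- r) F i x) = \sum_(i <- r) gavg M d (F i).
Proof. by rewrite /gavg exchange_big big_distrr. Qed.

Lemma gavg_avg M d (F : R -> seq R -> R) :
  gavg M d (fun x => avg M (F^~ x)) = avg M (fun a => gavg M d (F a)).
Proof. by rewrite /avg gavgZ gavg_sum. Qed.

(** The tensor product of the one-dimensional block multipliers, one per coordinate. *)
Fixpoint gblock M K s u x : R :=
  match s, x with
  | k :: s', a :: x' =>
      conv M K (block R k) (fun b => gblock M K s' (fun y => u (b :: y)) x') a
  | _, _ => u x
  end.

Lemma eq_gblock M K s u U x : u =1 U -> gblock M K s u x = gblock M K s U x.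
Proof. by move=> /funext->. Qed.

Lemma gblock_sum M K s (I : Type) (r : seq I) (c : I -> R) (F : I -> seq R -> R) x :
  gblock M K s (fun y => \sum_(i <- r) c i * F i y) x =
  \sum_(i <- r) c i * gblock M K s (F i) x.
Proof.
elim: s F x => [|k s IH] F [|a x] //=.
by rewrite -conv_sum; apply: eq_conv.
Qed.

Lemma gblock_add M K s u U x :
  gblock M K s (fun y => u y + U y) x = gblock M K s u x + gblock M K s U x.
Proof.
have := gblock_sum M K s [:: true; false] (fun=> 1) (fun c => if c then u else U) x.
rewrite !big_cons !big_nil !addr0 !mul1r => <-; apply: eq_gblock => y.
by rewrite !big_cons !big_nil !addr0 !mul1r.
Qed.

Lemma gblock_conv M K s k u a x :
  gblock M K s (fun y => conv M K (block R k) (fun b => u (b :: y)) a) x =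
  conv M K (block R k) (fun b => gblock M K s (fun y => u (b :: y)) x) a.
Proof.
rewrite /conv /avg big_distrr/=.
under [RHS]eq_bigr do rewrite mulrA.
rewrite -(gblock_sum _ _ _ _ _ (fun b y => u (b :: y))).
by apply: eq_gblock => y; rewrite big_distrr/=; apply: eq_bigr => b _; rewrite mulrA.
Qed.

Lemma norm_gblock_le M K L s u (B : R) x : (2 ^ L <= K)%N -> (2 * K <= M)%N ->
  all (fun k => k < L)%N s -> size x = size s -> (forall y, `|u y| <= B) ->
  `|gblock M K s u x| <= 6 ^+ size s * B.
Proof.
move=> LK KM; elim: s u x => [|k s IH] u [|a x]//=; first by rewrite mul1r.
case/andP=> kL sL [xs] uB; rewrite exprS -mulrA; apply: norm_conv_block_le => //.
  by rewrite (leq_trans _ LK)// leq_exp2l.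
by move=> b; apply: IH.
Qed.

(** Induction on the dimension, with [bessel] in the first coordinate while the others are fixed. *)
Lemma gblock_bessel M K L d u : (2 * K <= M)%N ->
  \sum_(s <- words (iota 0 L) d) \sum_(x <- words (nodes R M) d) gblock M K s u x ^+ 2 <=
  \sum_(x <- words (nodes R M) d) u x ^+ 2.
Proof.
move=> KM; elim: d u => [|d IH] u; first by rewrite !big_seq1.
rewrite !big_words.
apply: (@le_trans _ _ (\sum_(s <- words (iota 0 L) d) \sum_(x <- words (nodes R M) d)
    \sum_(b <- nodes R M) gblock M K s (fun y => u (b :: y)) x ^+ 2)).
  rewrite exchange_big/= ler_sum// => s _.
  under eq_bigr do rewrite big_words exchange_big/=.
  rewrite exchange_big/= ler_sum// => x _.
  have [->|M0] := posnP M; first by rewrite big1 ?sumr_ge0// => [i _|k _]; rewrite ?sqr_ge0// big_nil.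
  have M0' : 0 < M%:R^-1 :> R by rewrite invr_gt0 ltr0n.
  rewrite -(ler_pM2l M0') -[leRHS]/(avg M (fun b => gblock M K s (fun y => u (b :: y)) x ^+ 2)).
  apply: le_trans (bessel (r := iota 0 L) (a := block R) _ KM _); last first.
    move=> k _; rewrite -[in iota _ _](subn0 L) -/(index_iota 0 L) big_mkord.
    exact: sum_block_sqr.
  by rewrite big_distrr.
rewrite exchange_big/= -[leRHS]/(\sum_(a <- nodes R M) _).
under eq_bigr do rewrite exchange_big/=.
rewrite exchange_big/= [leLHS](eq_bigr (fun b => \sum_(s <- words (iota 0 L) d)
  \sum_(x <- words (nodes R M) d) gblock M K s (fun y => u (b :: y)) x ^+ 2)).
  by rewrite ler_sum.
by move=> b _; rewrite exchange_big.
Qed.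

(** The bound in each coordinate holds with all other coordinates frozen, so for a product one may
    choose, coordinate by coordinate, which factor to average. *)
Fixpoint slow M (c : R) s U : Prop :=
  if s is k :: s' then
    (forall a x, U (a :: x) <= c * 2 ^+ k * avg M (fun b => U (b :: x))) /\
    (forall a, slow M c s' (fun x => U (a :: x)))
  else True.

(** The first coordinate is [conv_block_exp_le]. For the others, freezing the first coordinate again
    leaves a block of some function, by [gblock_conv]. *)
Lemma slow_gblock M K L s n u : (2 ^ L.+1 <= K)%N -> (2 * K <= M)%N ->
  all (fun k => k < L)%N s ->
  slow M (20 * 3 ^+ n) s (fun x => `|gblock M K s u x| ^+ n.+1).
Proof.
move=> LK KM; elim: s u => [//|k s IH] u /= /andP[kL sL]; split => [a x|a].
  by apply: conv_block_exp_le => //; rewrite (leq_trans _ LK)// leq_exp2l.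
rewrite (_ : (fun x => _) = (fun x =>
    `|gblock M K s (fun y => conv M K (block R k) (fun b => u (b :: y)) a) x| ^+ n.+1)).
  exact: IH.
by apply/funext => x; rewrite gblock_conv.
Qed.

Fixpoint gmin s t : nat :=
  match s, t with k :: s', l :: t' => (minn k l + gmin s' t')%N | _, _ => 0 end.

(** By truncated subtraction [(k - l) + (l - k)] is [|k - l|], so this is the l1 distance. *)
Fixpoint gdist s t : nat :=
  match s, t with k :: s', l :: t' => (((k - l) + (l - k)) + gdist s' t')%N | _, _ => 0 end.

Lemma gmin_gdist s t : size s = size t -> (2 * gmin s t + gdist s t = sumn s + sumn t)%N.
Proof.
by elim: s t => [|k s IH] [|l t]//= [/IH]; rewrite /minn; case: ltnP; lia.
Qed.

Lemma gdistC s t : gdist s t = gdist t s.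
Proof. by elim: s t => [|k s IH] [|l t]//=; rewrite IH; congr addn; rewrite addnC. Qed.

(** In each coordinate the factor with the smaller index is replaced by its average, at the cost
    [c * 2 ^+ minn k l], and the averages then separate. *)
Lemma gavg_mul_slow M c s t U V : 0 <= c -> size s = size t ->
  (forall x, 0 <= U x) -> (forall x, 0 <= V x) -> slow M c s U -> slow M c t V ->
  gavg M (size s) (fun x => U x * V x) <=
  c ^+ size s * 2 ^+ gmin s t * (gavg M (size s) U * gavg M (size s) V).
Proof.
move=> c0; elim: s t U V => [|k s IH] [|l t] //= U V.
  by rewrite !gavg0 !mul1r.
move=> [st] U0 V0 [sU sU'] [sV sV']; set d := size s in IH *.
pose P a := gavg M d (fun x => U (a :: x)); pose Q a := gavg M d (fun x => V (a :: x)).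
have P0 a : 0 <= P a by exact: gavg_ge0.
have Q0 a : 0 <= Q a by exact: gavg_ge0.
rewrite !gavgS -/P -/Q.
apply: (@le_trans _ _ (c ^+ d * 2 ^+ gmin s t * avg M (fun a => P a * Q a))).
  by rewrite -avgZ; apply: le_avg => a; apply: IH.
rewrite (_ : c ^+ d.+1 * _ = c ^+ d * 2 ^+ gmin s t * (c * 2 ^+ minn k l)); last first.
  by rewrite exprS exprD; ring.
rewrite -[leRHS]mulrA ler_wpM2l ?mulr_ge0 ?exprn_ge0// /minn.
case: ltnP => _.
  rewrite mulrA -avgZ; apply: le_avg => a; rewrite ler_wpM2r// /P.
  by rewrite -gavg_avg -gavgZ; apply: le_gavg => x _; exact: sU.
rewrite [avg M P * _]mulrC mulrA -avgZ; apply: le_avg => a; rewrite mulrC ler_wpM2r// /Q.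
by rewrite -gavg_avg -gavgZ; apply: le_gavg => x _; exact: sV.
Qed.

End Grid.

(** * Block decomposition of real trigonometric polynomials with spectrum in the cross *)

Section TrigonometricPolynomials.
Variable R : realType.
Implicit Types (M K d L N : nat) (s t : seq nat) (x : seq R) (k : seq int).

Fixpoint dotp k x : R :=
  match k, x with m :: k', a :: x' => m%:~R * a + dotp k' x' | _, _ => 0 end.

Fixpoint gsym s k : R :=
  match s, k with l :: s', m :: k' => block R l `|m|%N * gsym s' k' | _, _ => 1 end.

Lemma conv_cos_int M K (a : nat -> R) (c : R) (m : int) (phi x : R) :
  (2 * K <= M)%N -> (`|m| < K)%N ->
  conv M K a (fun y => c * cos (m%:~R * y + phi)) x = a `|m|%N * c * cos (m%:~R * x + phi).
Proof.
move=> KM mK; rewrite (@eq_conv _ _ _ a a _ (fun y =>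
    \sum_(i <- [:: tt]) c * cos (m%:~R * y + phi)))//; last by move=> y; rewrite big_seq1.
rewrite conv_sum big_seq1 [a _ * c]mulrC -mulrA; congr (_ * _).
case: m mK => m mK /=; first exact: conv_cos.
have E (y : R) : cos ((Negz m)%:~R * y + phi) = cos (m.+1%:R * y + - phi).
  by rewrite NegzE mulrNz mulNr -cosN opprD opprK.
by rewrite E -(conv_cos a _ _ KM mK); apply: eq_conv.
Qed.

(** The arbitrary phase carries the induction: seen from one coordinate, the remaining ones only
    shift the phase. *)
Lemma gblock_cos M K s k (phi : R) x : (2 * K <= M)%N ->
  size s = size k -> size x = size k -> all (fun m : int => `|m| < K)%N k ->
  gblock M K s (fun y => cos (dotp k y + phi)) x = gsym s k * cos (dotp k x + phi).
Proof.
move=> KM; elim: s k phi x => [|l s IH] [|m k] phi [|a x]//=; first by rewrite mul1r.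
move=> [sk] [xk] /andP[mK kK].
rewrite (@eq_conv _ _ _ _ (block R l) _
    (fun b => gsym s k * cos (m%:~R * b + (dotp k x + phi))))//; last first.
  move=> b; rewrite addrA [m%:~R * b + _]addrC -addrA -IH//.
  by apply: eq_gblock => y; congr cos; ring.
by rewrite conv_cos_int// addrA.
Qed.

Lemma sum_gsym L k : all (fun m : int => `|m| <= 2 ^ L)%N k ->
  \sum_(s <- words (iota 0 L.+1) (size k)) gsym s k = 1.
Proof.
elim: k => [_|m k IH /andP[mL kL]]; first by rewrite big_seq1.
rewrite -[size _]/(size k).+1 big_words.
rewrite (eq_bigr (fun l => block R l `|m|%N)); last first.
  by move=> l _; rewrite -[RHS]mulr1 -(IH kL) big_distrr.
by rewrite -[iota _ _]/(index_iota 0 L.+1) big_mkord sum_block vallee1.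
Qed.

Lemma gsym_neq0 s k : size s = size k -> gsym s k != 0 ->
  (2 ^ sumn s <= 2 ^ size k * \prod_(m <- k) maxn 1 `|m|)%N.
Proof.
elim: s k => [|l s IH] [|m k]//=; first by rewrite big_nil.
move=> [sk]; rewrite mulf_eq0 negb_or => /andP[/block_neq0 lm /(IH _ sk) {}IH].
rewrite big_cons expnD expnS [X in (_ <= X)%N]mulnACA; exact: leq_mul.
Qed.

Definition trigsum (I : Type) (r : seq I) (alpha phi : I -> R) (k : I -> seq int)
    (x : seq R) : R :=
  \sum_(i <- r) alpha i * cos (dotp (k i) x + phi i).

(** On each frequency the symbols sum to 1, and by [gsym_neq0] those with [2 ^ sumn s > 2 ^ d * N]
    vanish. *)
Lemma trigpoly_decomposition (I : eqType) (r : seq I) (alpha phi : I -> R)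
    (k : I -> seq int) M K L N d x : (2 * K <= M)%N -> (2 ^ L < K)%N -> (N <= 2 ^ L)%N ->
  (forall i, i \in r -> size (k i) = d) ->
  (forall i, i \in r -> (\prod_(m <- k i) maxn 1 `|m| <= N)%N) ->
  size x = d ->
  trigsum r alpha phi k x =
  \sum_(s <- [seq s <- words (iota 0 L.+1) d | 2 ^ sumn s <= 2 ^ d * N]%N)
    gblock M K s (trigsum r alpha phi k) x.
Proof.
move=> KM LK NL kd kN xd; rewrite big_filter.
have kbnd i : i \in r -> all (fun m : int => `|m| <= 2 ^ L)%N (k i).
  move=> /kN; elim: (k i) => [//|m k' IH]; rewrite big_cons /= => mk.
  have k'0 : (0 < \prod_(m <- k') maxn 1 `|m|)%N by rewrite prodn_gt0// => m'; lia.
  apply/andP; split; last by apply: IH; nia.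
  apply: leq_trans NL; apply: leq_trans mk; nia.
under [RHS]eq_bigr do rewrite gblock_sum.
rewrite /trigsum.
rewrite exchange_big/= big_seq [RHS]big_seq; apply: eq_bigr => i ir.
rewrite -big_distrr/=; congr (_ * _).
rewrite -[LHS]mul1r -(sum_gsym (kbnd i ir)) (kd _ ir) big_distrl/=.
rewrite [LHS](bigID (fun s => 2 ^ sumn s <= 2 ^ d * N)%N)/= [X in _ + X]big1_seq ?addr0.
  rewrite big_seq_cond [RHS]big_seq_cond; apply: eq_bigr => s /andP[].
  rewrite mem_words => /andP[/eqP sd _] _; rewrite gblock_cos ?kd//.
  by apply: sub_all (kbnd _ ir) => m /leq_ltn_trans; exact.
move=> s /andP[sN]; rewrite mem_words => /andP[/eqP sd _].
have [->|/gsym_neq0] := eqVneq (gsym s (k i)) 0; first by rewrite mul0r.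
rewrite kd// sd => /(_ erefl) H; case/negP: sN.
by apply: (leq_trans H); rewrite leq_mul2l kN// orbT.
Qed.

Lemma sum_gdist_le (x : R) L t : 0 <= x < 1 ->
  \sum_(s <- words (iota 0 L) (size t)) x ^+ gdist s t <= (2 * (1 - x)^-1) ^+ size t.
Proof.
move=> x01; elim: t => [|l t IH]; first by rewrite big_seq1.
rewrite -[size _]/(size t).+1 big_words.
rewrite (eq_bigr (fun i => x ^+ ((i - l) + (l - i))%N *
    \sum_(s <- words (iota 0 L) (size t)) x ^+ gdist s t)); last first.
  by move=> k _; rewrite big_distrr; apply: eq_bigr => s _; rewrite /= -exprD.
have x0 : 0 <= x by case/andP: x01.
rewrite -big_distrl/= exprS ler_pM ?sumr_ge0// => [i _||].
- exact: exprn_ge0.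
- by move=> i _; exact: exprn_ge0.
- rewrite -[in iota _ _](subn0 L) -/(index_iota 0 L) big_mkord.
  exact: sum_geometric_distn_le.
Qed.

End TrigonometricPolynomials.

(** * The Nikolskii inequality on the grid *)

Lemma exists_root2 (R : realType) m : exists2 rho : R, 1 < rho & rho ^+ m.+1 = 2.
Proof.
have E : (2 `^ (m.+1%:R^-1)) ^+ m.+1 = 2 :> R.
  by rewrite -powR_mulrn ?powR_ge0// -powRrM mulVf ?powRr1// pnatr_eq0.
exists (2 `^ (m.+1%:R^-1)) => //; rewrite ltNge; apply/negP => /(exprn_ile1 m.+1 (powR_ge0 _ _)).
by rewrite E; lra.
Qed.

Lemma sum_sqr_le (R : realDomainType) (I : Type) (s : seq I) (a : I -> R) :
  (forall i, 0 <= a i) -> \sum_(i <- s) a i ^+ 2 <= (\sum_(i <- s) a i) ^+ 2.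
Proof.
move=> a0; elim: s => [|i s IH]; first by rewrite !big_nil expr0n.
rewrite !big_cons sqrrD -addrA lerD2l (le_trans IH)// lerDr mulrn_wge0//.
by rewrite mulr_ge0// sumr_ge0.
Qed.

Lemma grid_nikolskii (R : realType) (d n : nat) : exists2 C : R, 0 < C &
  forall N : nat, exists M0 : nat, forall M : nat, (M0 <= M)%N ->
  forall (I : eqType) (r : seq I) (alpha phi : I -> R) (k : I -> seq int),
  (forall i, i \in r -> size (k i) = d) ->
  (forall i, i \in r -> (\prod_(m <- k i) maxn 1 `|m| <= N)%N) ->
  gavg M d (fun x => `|trigsum r alpha phi k x| ^+ (2 * n.+3)) <=
  C * N%:R * gavg M d (fun x => `|trigsum r alpha phi k x| ^+ n.+3) ^+ 2.
Proof.
(* The weights of [sum_exp_le_pairs] will be [rho ^+ gdist s t], raised there to the power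
   [2 * n.+2 + 1]. The root is chosen so that [sg ^+ 4 = 2]: the gain [2^(- |s - t| / 2)] is then
   [sg^(- 2 |s - t|)]. *)
have [rho rho1 rhoE] := exists_root2 R (4 * (2 * n.+2).+1).-1.
have rho0 : 0 < rho by lra.
pose A := (2 * (1 - rho^-1)^-1) ^+ d.
have ri01 : 0 <= rho^-1 < 1 by rewrite invr_ge0 ltW//= invf_lt1.
have A0 : 0 < A.
  by rewrite exprn_gt0// mulr_gt0// invr_gt0 subr_gt0; case/andP: ri01.
pose c : R := 20 * 3 ^+ n.+2.
have c0 : 0 < c by rewrite mulr_gt0// exprn_gt0.
pose sg := rho ^+ (2 * n.+2).+1.
have sg0 : 0 < sg by rewrite exprn_gt0.
have sg4 : sg ^+ 4 = 2 by rewrite -exprM mulnC -rhoE.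
have rsg : rho <= sg by rewrite ler_eXnr// ltW.
(* The constant of [sum_exp_interpolation] for the uniform bound [6 ^+ d] of [norm_gblock_le]. *)
pose D : R := 8 * (4 * 6 ^+ d) ^+ n.+1.
have D0 : 0 < D by rewrite mulr_gt0// exprn_gt0// mulr_gt0// exprn_gt0.
exists (A ^+ (n.+3 + n.+2) * c ^+ d * A * 2 ^+ d * D ^+ 2).
  apply: mulr_gt0; last exact: exprn_gt0.
  apply: mulr_gt0; last exact: exprn_gt0.
  by apply: mulr_gt0 => //; apply: mulr_gt0; exact: exprn_gt0.
(* Since [N < 2 ^ N], this [L] covers all frequencies; the crude choice is harmless as the constant
   does not involve [L]. [K] leaves room for the kernels of [vallee s.+1] with [s <= L], and
   [2 * K <= M] prevents aliasing. *)
move=> N; pose L := N; pose K := (2 ^ L.+2)%N.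
exists (2 * K)%N => M KM I r alpha phi k kd kN; set F := trigsum _ _ _ _.
have M0 : (0 < M)%N by rewrite (leq_trans _ KM)// muln_gt0 expn_gt0.
pose W := words (iota 0 L.+1) d.
pose S := [seq s <- W | 2 ^ sumn s <= 2 ^ d * N]%N.
have SW s : s \in S -> size s = d /\ all (fun l => l < L.+1)%N s.
  rewrite mem_filter mem_words => /andP[_ /andP[/eqP-> al]]; split => //.
  by apply: sub_all al => l; rewrite inE mem_iota.
pose g s x := `|gblock M K s F x|.
have Fg x : size x = d -> `|F x| <= \sum_(s <- S) g s x.
  move=> xd; rewrite /F (@trigpoly_decomposition R I r alpha phi k M K L N d x)// -/F.
  - exact: ler_norm_sum.
  - by rewrite /K ltn_exp2l.
  - by rewrite ltnW// ltn_expl.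
pose Y s := gavg M d (fun x => g s x ^+ n.+3).
have g0 s x : 0 <= g s x by exact: normr_ge0.
have Y0 s : 0 <= Y s by apply: gavg_ge0 => x; rewrite exprn_ge0.
have sumY : \sum_(s <- S) Y s <= D * gavg M d (fun x => `|F x| ^+ n.+3).
  apply: (@le_trans _ _ (\sum_(s <- W) Y s)).
    rewrite big_filter [leRHS](bigID (fun s => 2 ^ sumn s <= 2 ^ d * N)%N)/=.
    by rewrite lerDl sumr_ge0.
  rewrite /Y /gavg -big_distrr/= mulrCA ler_wpM2l ?exprn_ge0 ?invr_ge0//.
  apply: (@sum_exp_interpolation _ _ _ _ _ (gblock M K) (6 ^+ d) n F).
  - by rewrite exprn_gt0.
  - by move=> *; exact: gblock_add.
  - move=> s v B x; rewrite !mem_words => /andP[/eqP sd al] /andP[/eqP xd _] vB.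
    rewrite -sd; apply: (@norm_gblock_le _ _ _ L.+1) => //.
    + by rewrite /K leq_exp2l.
    + by apply: sub_all al => l; rewrite inE mem_iota.
    + by rewrite xd sd.
  - by move=> v; exact: gblock_bessel.
(* Here [2 ^+ gmin s t] equals [2^((|s| + |t|) / 2)] times [sg^(- 2 gdist s t)]. One half of the
   last power pays for the weight on the left, the other is at most [rho^-1 ^+ gdist s t]. *)
have pairs s t : s \in S -> t \in S -> sg ^+ gdist s t *
    gavg M d (fun x => g s x ^+ n.+3 * g t x ^+ n.+3) <=
    c ^+ d * (rho^-1 ^+ gdist s t * ((sg ^+ (2 * sumn s) * Y s) * (sg ^+ (2 * sumn t) * Y t))).
  move=> /SW[sd sL] /SW[td tL].
  have st : size s = size t by rewrite sd td.
  have := @gavg_mul_slow _ M c s t (fun x => g s x ^+ n.+3) (fun x => g t x ^+ n.+3)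
    (ltW c0) st (fun x => exprn_ge0 _ (normr_ge0 _)) (fun x => exprn_ge0 _ (normr_ge0 _))
    (slow_gblock n.+2 F (leqnn _) KM sL) (slow_gblock n.+2 F (leqnn _) KM tL).
  rewrite sd -/(Y s) -/(Y t) => H.
  have sgd : 0 < sg ^+ gdist s t by rewrite exprn_gt0.
  have E : sg ^+ (2 * sumn s) * sg ^+ (2 * sumn t) =
      2 ^+ gmin s t * sg ^+ gdist s t ^+ 2.
    rewrite -exprD -mulnDr -(gmin_gdist st).
    by rewrite mulnDr mulnA (mulnC _ (gdist s t)) exprD !exprM -[sg ^+ 2 ^+ 2]exprM sg4.
  rewrite (le_trans (ler_wpM2l (ltW sgd) H))//.
  rewrite (_ : rho^-1 ^+ _ * _ = rho^-1 ^+ gdist s t * (2 ^+ gmin s t * sg ^+ gdist s t ^+ 2)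
     * (Y s * Y t)); last by rewrite -E; ring.
  rewrite (_ : sg ^+ _ * _ = c ^+ d * (sg ^+ gdist s t * 2 ^+ gmin s t * (Y s * Y t))); last by ring.
  rewrite ler_wpM2l ?exprn_ge0 ?(ltW c0)// ler_wpM2r ?(mulr_ge0 (Y0 s) (Y0 t))//.
  rewrite mulrC [rho^-1 ^+ _ * _]mulrCA ler_wpM2l ?exprn_ge0//.
  by rewrite expr2 mulrA ler_peMl ?(ltW sgd)// -exprMn exprn_ege1// mulrC ler_pdivlMr// mul1r.
pose Z s := sg ^+ (2 * sumn s) * Y s.
(* The factor [N] enters here: [sg ^+ (4 |s|) = 2 ^+ |s|], which is at most [2 ^ d * N] on [S]. *)
have Z2 s : s \in S -> Z s ^+ 2 <= 2 ^+ d * N%:R * Y s ^+ 2.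
  rewrite mem_filter => /andP[sN _]; rewrite /Z exprMn ler_wpM2r ?sqr_ge0//.
  rewrite -exprM mulnAC.
  by rewrite exprM sg4 -!natrX -natrM ler_nat.
have sumr s : s \in S -> \sum_(t <- S) rho^-1 ^+ gdist t s <= A.
  move=> /SW[sd _]; rewrite /A -sd; apply: le_trans (sum_gdist_le L.+1 s ri01).
  rewrite big_filter sd [leRHS](bigID (fun s => 2 ^ sumn s <= 2 ^ d * N)%N)/=.
  by rewrite lerDl sumr_ge0// => t _; rewrite exprn_ge0// invr_ge0 ltW.
(* A Schur test: [2 Z s Z t <= Z s ^ 2 + Z t ^ 2], and the rows of the symmetric matrix
   [rho^-1 ^+ gdist s t] sum to at most [A]. *)
have ZZ : \sum_(s <- S) \sum_(t <- S) rho^-1 ^+ gdist s t * (Z s * Z t) <=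
    A * \sum_(s <- S) Z s ^+ 2.
  have H : \sum_(s <- S) \sum_(t <- S) rho^-1 ^+ gdist s t * Z t ^+ 2 <=
      A * \sum_(s <- S) Z s ^+ 2.
    rewrite exchange_big/= big_distrr/= big_seq [leRHS]big_seq ler_sum// => t tS.
    by rewrite -big_distrl/= ler_wpM2r ?sqr_ge0// sumr.
  have H' : \sum_(s <- S) \sum_(t <- S) rho^-1 ^+ gdist s t * Z s ^+ 2 <=
      A * \sum_(s <- S) Z s ^+ 2.
    rewrite exchange_big/= (le_trans _ H)// ler_sum// => s _; rewrite ler_sum// => t _.
    by rewrite gdistC.
  have : \sum_(s <- S) \sum_(t <- S) rho^-1 ^+ gdist s t * (Z s * Z t) <=
    2^-1 * (\sum_(s <- S) \sum_(t <- S) rho^-1 ^+ gdist s t * Z s ^+ 2 +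
    \sum_(s <- S) \sum_(t <- S) rho^-1 ^+ gdist s t * Z t ^+ 2).
    rewrite -big_split big_distrr/= ler_sum// => s _.
    rewrite -big_split big_distrr/= ler_sum// => t _.
    rewrite -mulrDr [leRHS]mulrCA ler_wpM2l ?exprn_ge0 ?invr_ge0 ?(ltW rho0)//.
    by have := sqr_ge0 (Z s - Z t); rewrite sqrrB; lra.
  lra.
apply: (@le_trans _ _ (A ^+ (n.+3 + n.+2) * \sum_(s <- S) \sum_(t <- S)
    sg ^+ gdist s t * gavg M d (fun x => g s x ^+ n.+3 * g t x ^+ n.+3))).
  rewrite [leRHS](_ : _ = gavg M d (fun x => A ^+ (n.+3 + n.+2) *
      \sum_(s <- S) \sum_(t <- S) sg ^+ gdist s t * (g s x ^+ n.+3 * g t x ^+ n.+3))); last first.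
    rewrite gavgZ gavg_sum; congr (_ * _); apply: eq_bigr => s _.
    by rewrite gavg_sum; apply: eq_bigr => t _; rewrite gavgZ.
  apply: le_gavg => x xd.
  have Fgx := Fg _ xd.
  apply: (@le_trans _ _ ((\sum_(s <- S) g s x) ^+ (2 * n.+3))).
    by rewrite lerXn2r ?nnegrE ?sumr_ge0.
  have := @sum_exp_le_pairs R _ S (fun s => g s x) (fun s t => rho ^+ gdist s t) A n.+2
    (fun s => normr_ge0 _) (fun s t => exprn_gt0 _ rho0).
  move=> /(_ _)/le_trans; apply.
    by move=> t /sumr/(le_trans _); apply; under eq_bigr do rewrite -exprVn.
  apply: ler_wpM2l; first exact: exprn_ge0 (ltW A0).
  apply: ler_sum => s _; apply: ler_sum => t _.
  by rewrite /sg -!exprM mulnC.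
pose G := gavg M d (fun x => `|F x| ^+ n.+3); rewrite -/G -/(Y _) in sumY *.
have G0 : 0 <= G by apply: gavg_ge0 => x; rewrite exprn_ge0.
rewrite [leRHS](_ : _ = A ^+ (n.+3 + n.+2) * (c ^+ d * (A *
    (2 ^+ d * N%:R * (D * G) ^+ 2)))); last by clearbody A c D G; ring.
apply: ler_wpM2l; first exact: exprn_ge0 (ltW A0).
apply: (@le_trans _ _ (c ^+ d * (A * \sum_(s <- S) Z s ^+ 2))).
  apply: (@le_trans _ _ (c ^+ d * \sum_(s <- S) \sum_(t <- S) rho^-1 ^+ gdist s t * (Z s * Z t))).
    rewrite big_distrr/= big_seq [leRHS]big_seq; apply: ler_sum => s sS.
    rewrite big_distrr/= big_seq [leRHS]big_seq; apply: ler_sum => t tS; exact: pairs.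
  by apply: ler_wpM2l ZZ; exact: exprn_ge0 (ltW c0).
apply: ler_wpM2l; first exact: exprn_ge0 (ltW c0).
apply: ler_wpM2l; first exact: ltW.
apply: (@le_trans _ _ (2 ^+ d * N%:R * \sum_(s <- S) Y s ^+ 2)).
  by rewrite big_distrr/= big_seq [leRHS]big_seq; apply: ler_sum.
apply: ler_wpM2l; first by rewrite mulr_ge0 ?exprn_ge0.
apply: (le_trans (sum_sqr_le _ Y0)); rewrite lerXn2r// nnegrE; first exact: sumr_ge0.
exact: mulr_ge0 (ltW D0) G0.
Qed.

(** * Real and imaginary parts of cross polynomials; boundedness, Lipschitz continuity and
    measurability *)

Section CrossPolynomials.
Variable R : realType.

Lemma dotp_tnth d (k : d.-tuple int) (x : d.-tuple R) :
  dotp k x = \sum_(j < d) (tnth k j)%:~R * tnth x j.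
Proof.
elim: d k x => [|d IH] k x; first by rewrite big_ord0 tuple0.
case/tupleP: k => m k; case/tupleP: x => a x; rewrite big_ord_recl !tnth0 /= IH.
by congr (_ + _); apply: eq_bigr => j _; rewrite !tnthS.
Qed.

(** Each frequency gives a cosine and a sine, and [- sin t = cos (t + pi / 2)] turns the sine into a
    cosine with a phase; the boolean in the index tells the two apart. *)
Lemma trig_cross_trigsum d N (f : d.-tuple R -> R[i]) : trig_cross R d N f ->
  exists (r : seq (d.-tuple int * bool)) (alpha beta phi : d.-tuple int * bool -> R),
  (forall i, i \in r -> (\prod_(m <- i.1) maxn 1 `|m| <= N)%N) /\
  (forall x : d.-tuple R, complex.Re (f x) = trigsum r alpha phi (fun i => i.1) x /\
    complex.Im (f x) = trigsum r beta phi (fun i => i.1) x).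
Proof.
case=> c fE; pose H := fset_set (hyperbolic_cross d N).
exists [seq (k, b) | k <- finmap.enum_fset H, b <- [:: true; false]].
exists (fun i => if i.2 then complex.Re (c i.1) else complex.Im (c i.1)).
exists (fun i => if i.2 then complex.Im (c i.1) else - complex.Re (c i.1)).
exists (fun i => if i.2 then 0 else pi / 2); split.
  move=> _ /allpairsP[[k b] [/= kH _ ->]]/=.
  move: kH; rewrite in_fset_set ?inE; last exact: finite_hyperbolic_cross.
  by rewrite big_tuple.
move=> x; rewrite fE fsbig_finite; last exact: finite_hyperbolic_cross.
have E k : c k * char_torus k x =
    Complex (complex.Re (c k) * cos (dotp k x) - complex.Im (c k) * sin (dotp k x))
      (complex.Re (c k) * sin (dotp k x) + complex.Im (c k) * cos (dotp k x)).
  by rewrite /char_torus -dotp_tnth /expi; case: (c k).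
have ReS (s : seq (d.-tuple int)) (F : d.-tuple int -> R[i]) :
    complex.Re (\sum_(k <- s) F k) = \sum_(k <- s) complex.Re (F k).
  by apply: (big_morph _ _ erefl) => -[? ?] [? ?].
have ImS (s : seq (d.-tuple int)) (F : d.-tuple int -> R[i]) :
    complex.Im (\sum_(k <- s) F k) = \sum_(k <- s) complex.Im (F k).
  by apply: (big_morph _ _ erefl) => -[? ?] [? ?].
rewrite ReS ImS /trigsum; split; rewrite big_allpairs; apply: eq_bigr => k _;
  by rewrite E /= !big_cons big_nil/= !addr0 cosDpihalf; ring.
Qed.

Lemma ler_norm_cosB (a b : R) : `|cos a - cos b| <= `|a - b|.
Proof.
wlog ab : a b / a <= b.
  move=> H; have [/H//|/ltW/H] := leP a b; by rewrite distrC [leRHS]distrC.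
have [|c _ E] := @MVT_segment R cos (fun x => - sin x) _ _ ab (fun x _ => is_derive_cos x).
  exact/continuous_subspaceT/continuous_cos.
rewrite distrC E [leRHS]distrC normrM normrN ler_piMl//; exact: sin_max.
Qed.

(** Preimages are Borel, and Borel sets are Caratheodory measurable. *)
Lemma measurable_fun_lspace d (g : d.-tuple (measurableTypeR R) -> R) :
  measurable_fun setT g -> measurable_fun [set: lspace R d] g.
Proof.
move=> mg _ Y mY; rewrite setTI; apply: sub_caratheodory; apply: sub_sigma_algebra.
by rewrite -[X in measurable X]setTI; exact: mg.
Qed.

(* Functions on R^d are represented by functions of the sequence of coordinates. *)
Definition bounded_lipschitz d (g : seq R -> R) (B : R) : Prop :=
  [/\ 0 <= B, measurable_fun [set: lspace R d] (fun x : d.-tuple R => g x),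
   (forall x : d.-tuple R, `|g x| <= B) &
   (forall (x y : d.-tuple R) (e : R), 0 <= e -> (forall j, `|tnth x j - tnth y j| <= e) ->
     `|g x - g y| <= B * e)].

Lemma bounded_lipschitz_cst d c : bounded_lipschitz d (fun=> c) `|c|.
Proof.
split=> // x y e e0 _; by rewrite subrr normr0 mulr_ge0.
Qed.

Lemma bounded_lipschitzD d g h B C : bounded_lipschitz d g B -> bounded_lipschitz d h C ->
  bounded_lipschitz d (fun x => g x + h x) (B + C).
Proof.
move=> [B0 mg gB gL] [C0 mh hC hL]; split.
- exact: addr_ge0.
- exact: measurable_funD.
- by move=> x; rewrite (le_trans (ler_normD _ _))// lerD.
- move=> x y e e0 xy; rewrite opprD addrACA (le_trans (ler_normD _ _))// mulrDl.
  by rewrite lerD// ?gL ?hL.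
Qed.

Lemma bounded_lipschitzM d g h B C : bounded_lipschitz d g B -> bounded_lipschitz d h C ->
  bounded_lipschitz d (fun x => g x * h x) (2 * B * C).
Proof.
move=> [B0 mg gB gL] [C0 mh hC hL]; split.
- by rewrite !mulr_ge0.
- exact: measurable_funM.
- move=> x; rewrite normrM -mulrA (le_trans (ler_pM _ _ (gB x) (hC x)))//.
  by have := mulr_ge0 B0 C0; lra.
- move=> x y e e0 xy.
  rewrite (_ : g x * h x - g y * h y = (g x - g y) * h x + g y * (h x - h y)); last by ring.
  rewrite (le_trans (ler_normD _ _))// !normrM.
  rewrite (_ : 2 * B * C * e = (B * e) * C + B * (C * e)); last by ring.
  by rewrite lerD// ler_pM// ?gL ?hL.
Qed.

Lemma bounded_lipschitzX d g B n : bounded_lipschitz d g B ->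
  exists C, bounded_lipschitz d (fun x => g x ^+ n) C.
Proof.
move=> gB; elim: n => [|n [C IH]].
  by exists `|1|; under eq_fun do rewrite expr0; exact: bounded_lipschitz_cst.
by exists (2 * B * C); under eq_fun do rewrite exprS; exact: bounded_lipschitzM.
Qed.

Lemma bounded_lipschitz_cos d (k : seq int) (phi : R) : size k = d ->
  bounded_lipschitz d (fun x => cos (dotp k x + phi)) (1 + \sum_(m <- k) `|m%:~R|).
Proof.
move=> kd; have S0 : 0 <= \sum_(m <- k) `|m%:~R : R| by rewrite sumr_ge0.
split; first by rewrite addr_ge0.
- apply: measurable_fun_lspace; apply: measurableT_comp.
    apply: continuous_measurable_fun; exact: continuous_cos.
  apply: measurable_funD; last exact: measurable_cst.
  move/eqP: kd => kd; pose k' := Tuple kd.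
  rewrite (_ : (fun x => _) = (fun x : d.-tuple (measurableTypeR R) =>
      \sum_(j <- index_enum 'I_d) (tnth k' j)%:~R * tnth x j)); last first.
    by apply/funext => x; rewrite -[k]/(tval k') dotp_tnth.
  apply: measurable_sum => j; apply: measurable_funM; first exact: measurable_cst.
  exact: measurable_tnth.
- by move=> x; rewrite (le_trans (cos_max _))// lerDl.
- move=> x y e e0 xy; rewrite (le_trans (ler_norm_cosB _ _))//.
  move/eqP: kd => kd; pose k' := Tuple kd.
  rewrite opprD addrACA subrr addr0 -[k]/(tval k') !dotp_tnth -sumrB.
  rewrite big_tuple mulrDl mul1r (le_trans (ler_norm_sum _ _ _))//.
  rewrite -[leLHS]add0r lerD// big_distrl/= ler_sum// => j _.
  by rewrite -mulrBr normrM ler_wpM2l.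
Qed.

Lemma bounded_lipschitz_trigsum d (I : eqType) (r : seq I) (alpha phi : I -> R)
    (k : I -> seq int) : (forall i, i \in r -> size (k i) = d) ->
  exists B, bounded_lipschitz d (trigsum r alpha phi k) B.
Proof.
elim: r => [|i r IH] kd.
  exists `|0 : R|; rewrite (_ : trigsum _ _ _ _ = fun=> 0); first exact: bounded_lipschitz_cst.
  by apply/funext => x; rewrite /trigsum big_nil.
have [|B IHB] := IH; first by move=> j jr; apply: kd; rewrite inE jr orbT.
have ki := kd i (mem_head _ _).
exists (2 * `|alpha i| * (1 + \sum_(m <- k i) `|m%:~R|) + B).
rewrite (_ : trigsum _ _ _ _ = fun x =>
    alpha i * cos (dotp (k i) x + phi i) + trigsum r alpha phi k x); last first.
  by apply/funext => x; rewrite /trigsum big_cons.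
exact: (bounded_lipschitzD (bounded_lipschitzM (bounded_lipschitz_cst _ _)
  (bounded_lipschitz_cos _ ki)) IHB).
Qed.

End CrossPolynomials.

(** * Comparison of torus integrals with grid averages *)

Lemma words_map (T U : Type) (f : T -> U) (A : seq T) d :
  words (map f A) d = map (map f) (words A d).
Proof.
elim: d => //= d ->; rewrite allpairs_mapl allpairs_mapr map_allpairs.
by [].
Qed.

Lemma uniq_words (T : eqType) (A : seq T) d : uniq A -> uniq (words A d).
Proof.
move=> uA; elim: d => //= d IH; apply: allpairs_uniq => // -[a w] [b v] _ _ /= [-> ->//].
Qed.

Section RiemannSums.
Variables (R : realType) (d : nat).
Implicit Types (M : nat) (w : seq nat).

Lemma gavg_cst M c : (0 < M)%N -> gavg M d (fun=> c) = c :> R.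
Proof.
move=> M0; elim: d => [|n IH]; first by rewrite gavg0.
by rewrite gavgS; under eq_avg do rewrite IH; exact: avg_cst.
Qed.

Lemma node_ge0 M j : 0 <= node R M j.
Proof. by rewrite /node divr_ge0// mulr_ge0// ltW// twopi_gt0. Qed.

(** The integer part of [a * M / (2 * pi)] selects the interval that contains [a]; this yields both
    that the cells are disjoint and that they cover the torus. *)
Lemma node_itv M j (a : R) : (0 < M)%N ->
  (node R M j <= a < node R M j.+1) = (0 <= a) && (Num.truncn (a * M%:R / (2 * pi)) == j).
Proof.
move=> M0; have M0' : 0 < M%:R :> R by rewrite ltr0n.
have E (k : nat) : (node R M k <= a) = (k%:R <= a * M%:R / (2 * pi)).
  by rewrite /node ler_pdivrMr// ler_pdivlMr ?twopi_gt0// [_ * k%:R]mulrC.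
have [a0|a0] /= := leP 0 a; last first.
  by apply/negbTE; rewrite negb_and -ltNge (lt_le_trans a0)// node_ge0.
have q0 : 0 <= a * M%:R / (2 * pi).
  by rewrite divr_ge0//; [rewrite mulr_ge0|rewrite ltW// twopi_gt0].
by rewrite truncn_eq// E !ltNge E.
Qed.

Definition cell M w : set (lspace R d) :=
  [set x : d.-tuple R | forall i : 'I_d, node R M (nth 0%N w i) <= tnth x i < node R M (nth 0%N w i).+1].

Lemma measurable_cell M w : measurable (cell M w).
Proof.
rewrite (_ : cell M w = \bigcap_(i in [set: 'I_d])
  ((fun x : lspace R d => tnth (x : d.-tuple R) i) @^-1`
     `[node R M (nth 0%N w i), node R M (nth 0%N w i).+1[%classic)).
  apply: fin_bigcap_measurable => // i _.
  rewrite -[X in measurable X]setTI.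
  have := @measurable_fun_lspace R d (fun x => tnth x i) (measurable_tnth i).
  by apply => //; exact: measurable_itv.
apply/seteqP; split => [x xA i _|x xA i] /=; first by rewrite in_itv; exact: xA.
by have := xA i I; rewrite /= in_itv.
Qed.

Lemma measure_cell M w : (0 < M)%N -> w \in words (iota 0 M) d ->
  torus_measure R d (cell M w) = (M%:R^-1 ^+ d)%:E.
Proof.
move=> M0; rewrite mem_words => /andP[/eqP wd /allP al].
have M0' : 0 < M%:R :> R by rewrite ltr0n.
pose A (i : 'I_d) := `[node R M (nth 0%N w i), node R M (nth 0%N w i).+1[%classic.
rewrite (_ : cell M w = [set x : d.-tuple R | forall i, A i (tnth x i)]); last first.
  by apply/seteqP; split => x xA i; have := xA i; rewrite /A/= in_itv.
rewrite torus_measure_box.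
- rewrite (eq_bigr (fun=> (M%:R^-1)%:E)); last first.
    move=> i _; rewrite lebesgue_measure_itv/= lte_fin ltr_pM2r ?invr_gt0//.
    rewrite ltr_pM2l ?twopi_gt0// ltr_nat ltnSn -EFinD -EFinM; congr EFin.
    have p0 : pi != 0 :> R by rewrite gt_eqF ?pi_gt0.
    by rewrite /node -natr1; move: (pi : R) p0 => p p0; field; rewrite p0 gt_eqF.
  by rewrite prodEFin prodr_const card_ord.
- by move=> i; exact: measurable_itv.
- move=> i a; rewrite /A /= !in_itv/= => /andP[na an].
  have iM : (nth 0%N w i < M)%N.
    have : nth 0%N w i \in w by rewrite mem_nth// wd.
    by move=> /al; rewrite inE mem_iota.
  rewrite (le_trans (node_ge0 _ _) na)/=.
  rewrite (lt_le_trans an)// /node ler_pdivrMr// ler_pM2l ?twopi_gt0//.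
  by rewrite ler_nat.
Qed.

Lemma torus_cells M : (0 < M)%N ->
  torus R d = \big[setU/set0]_(w <- words (iota 0 M) d) cell M w.
Proof.
move=> M0; have M0' : 0 < M%:R :> R by rewrite ltr0n.
rewrite -bigcup_seq; apply/seteqP; split => [x xT|x [w /= wW xw] i].
  exists [seq Num.truncn (a * M%:R / (2 * pi)) | a <- (x : d.-tuple R)] => /=.
    rewrite mem_words size_map size_tuple eqxx/=; apply/allP => _ /mapP[a /tnthP[i ->] ->].
    rewrite inE mem_iota add0n leq0n/=; have /andP[x0 x2] := xT i.
    rewrite truncn_lt_nat; last by rewrite divr_ge0//; [rewrite mulr_ge0|rewrite ltW// twopi_gt0].
    by rewrite ltr_pdivrMr ?twopi_gt0// mulrC ltr_pM2l.
  move=> i; rewrite node_itv// (nth_map 0) ?size_tuple// -tnth_nth eqxx andbT.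
  by case/andP: (xT i).
move: wW; rewrite mem_words => /andP[/eqP wd /allP al].
have iM : (nth 0%N w i < M)%N.
  have : nth 0%N w i \in w by rewrite mem_nth// wd.
  by move=> /al; rewrite inE mem_iota.
have /andP[na an] := xw i.
rewrite (le_trans (node_ge0 _ _) na)/=.
rewrite (lt_le_trans an)// /node ler_pdivrMr// ler_pM2l ?twopi_gt0//.
by rewrite ler_nat.
Qed.

Lemma integral_torus_cells M (G : lspace R d -> \bar R) : (0 < M)%N ->
  measurable_fun [set: lspace R d] G -> (forall x, 0 <= G x)%E ->
  (\int[torus_measure R d]_(x in torus R d) G x =
   \sum_(w <- words (iota 0 M) d) \int[torus_measure R d]_(x in cell M w) G x)%E.
Proof.
move=> M0 mG G0; rewrite (torus_cells M0) ge0_integral_bigsetU//.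
- exact: measurable_cell.
- by rewrite uniq_words// iota_uniq.
- move=> w v /=; rewrite !mem_words => /andP[/eqP wd _] /andP[/eqP vd _] [x [xw xv]].
  apply: (@eq_from_nth _ 0%N) => [|i]; first by rewrite wd vd.
  rewrite wd => id; have := xw (Ordinal id); have := xv (Ordinal id).
  by rewrite !node_itv// => /andP[_ /eqP<-] /andP[_ /eqP<-].
- exact: measurable_funTS.
Qed.

Lemma sum_cells M (g : seq R -> R) : (0 < M)%N ->
  (\sum_(w <- words (iota 0 M) d) \int[torus_measure R d]_(x in cell M w)
     (cst (g [seq node R M j | j <- w])%:E) x)%E = (gavg M d g)%:E.
Proof.
move=> M0; rewrite big_seq (eq_bigr (fun w => (M%:R^-1 ^+ d * g [seq node R M j | j <- w])%:E)).
  by rewrite -big_seq sumEFin -big_distrr/= /gavg words_map big_map.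
by move=> w wW; rewrite integral_cst ?measure_cell// -?EFinM 1?mulrC//; exact: measurable_cell.
Qed.

Lemma cell_dist M w (x p : d.-tuple R) : (0 < M)%N -> cell M w x ->
  (forall j, tnth p j = node R M (nth 0%N w j)) ->
  forall j, `|tnth x j - tnth p j| <= 2 * pi / M%:R.
Proof.
move=> M0 xw pw j; have /andP[nx xn] := xw j.
rewrite pw ger0_norm ?subr_ge0// lerBlDr (le_trans (ltW xn))// /node -[(nth _ _ _).+1%:R]natr1.
by rewrite mulrDr mulr1 mulrDl addrC.
Qed.

(** On a cell [g] differs from its value at the node by at most [B * (2 * pi / M)], and the torus
    has measure 1. The upper bound will serve for the power [2r], the lower one for the power
    [r]. *)
Lemma riemann_sum M (g : seq R -> R) (B : R) : (0 < M)%N -> bounded_lipschitz d g B ->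
  (forall x : d.-tuple R, 0 <= g x) ->
  (\int[torus_measure R d]_(x in torus R d) (g x)%:E <= (gavg M d g + B * (2 * pi) / M%:R)%:E)%E /\
  ((gavg M d g)%:E <=
    \int[torus_measure R d]_(x in torus R d) (g x)%:E + (B * (2 * pi) / M%:R)%:E)%E.
Proof.
move=> M0 [B0 mg gB gL] g0.
have M0' : 0 < M%:R :> R by rewrite ltr0n.
set e := B * (2 * pi) / M%:R.
have e0 : 0 <= e by rewrite divr_ge0// mulr_ge0// ltW// twopi_gt0.
have mgE : measurable_fun [set: lspace R d] (fun x => (g (x : d.-tuple R))%:E).
  exact/measurable_EFinP.
have near w (x : lspace R d) : w \in words (iota 0 M) d -> cell M w x ->
    `|g (x : d.-tuple R) - g [seq node R M j | j <- w]| <= e.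
  rewrite mem_words => /andP[/eqP wd _] xw.
  have sp : size [seq node R M j | j <- w] == d by rewrite size_map wd.
  have -> : e = B * (2 * pi / M%:R) by rewrite mulrA.
  rewrite (_ : [seq _ | _ <- w] = Tuple sp)//; apply: gL.
    by rewrite divr_ge0// ltW// twopi_gt0.
  apply: (cell_dist M0 xw) => j.
  by rewrite (tnth_nth 0)/= (nth_map 0%N)// wd.
have gw0 w : w \in words (iota 0 M) d -> 0 <= g [seq node R M j | j <- w].
  rewrite mem_words => /andP[/eqP wd _].
  have sp : size [seq node R M j | j <- w] == d by rewrite size_map wd.
  exact: (g0 (Tuple sp)).
split.
  rewrite (integral_torus_cells M0 mgE); last by move=> x; rewrite lee_fin.
  rewrite -(gavg_cst e M0) -gavgD -sum_cells// big_seq [leRHS]big_seq.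
  apply: lee_sum => w wW; apply: ge0_le_integral => //.
  - exact: measurable_cell.
  - by move=> x _; rewrite lee_fin.
  - exact: measurable_funTS.
  - move=> x xw; rewrite lee_fin -lerBlDl (le_trans (ler_norm _))//; exact: near.
rewrite -sum_cells//.
(* The error is written as the integral of a constant so that it splits over the cells together with
   [g]. *)
have -> : e%:E = (\int[torus_measure R d]_(x in torus R d) (cst e%:E) x)%E.
  rewrite integral_cst ?torus_measure_torus ?mule1//.
  rewrite (torus_cells M0); apply: bigsetU_measurable => w _; exact: measurable_cell.
have mT : measurable (torus R d).
  rewrite (torus_cells M0); apply: bigsetU_measurable => w _; exact: measurable_cell.
have mge : measurable_fun [set: lspace R d] (fun x => (g (x : d.-tuple R))%:E + cst e%:E x)%E.
  by apply: emeasurable_funD => //; exact: measurable_cst.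
rewrite -(ge0_integralD _ mT _ (measurable_funTS mgE) _ (measurable_cst _)); last 2 first.
- by move=> x _; rewrite lee_fin.
- by move=> x _; rewrite lee_fin.
rewrite (integral_torus_cells M0 mge); last first.
  by move=> x; rewrite adde_ge0// lee_fin.
rewrite big_seq [leRHS]big_seq; apply: lee_sum => w wW.
apply: (ge0_le_integral _ (measurable_cell M w)).
- by move=> x _; rewrite lee_fin gw0.
- exact: measurable_cst.
- exact: measurable_funTS mge.
- move=> x xw; rewrite /= -EFinD lee_fin addrC -lerBlDr (le_trans (ler_norm _))// distrC.
  exact: near.
Qed.

Lemma measurable_torus : measurable (torus R d).
Proof.
rewrite (torus_cells (ltn0Sn 0)); apply: bigsetU_measurable => w _; exact: measurable_cell.
Qed.

End RiemannSums.

(** * The Nikolskii inequality on the torus *)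

Lemma exprD_le_max (R : realDomainType) (a b : R) n : 0 <= a -> 0 <= b ->
  (a + b) ^+ n <= 2 ^+ n * (a ^+ n + b ^+ n).
Proof.
move=> a0 b0; wlog ab : a b a0 b0 / a <= b.
  move=> H; have [/H->//|/ltW/H] := leP a b; rewrite addrC [a ^+ n + _]addrC; exact.
apply: (@le_trans _ _ ((2 * b) ^+ n)).
  by rewrite lerXn2r ?nnegrE ?addr_ge0 ?mulr_ge0//; lra.
by rewrite exprMn ler_wpM2l ?exprn_ge0// lerDr exprn_ge0.
Qed.

Lemma normc_sqr (R : rcfType) (z : R[i]) :
  Normc.normc z ^+ 2 = complex.Re z ^+ 2 + complex.Im z ^+ 2.
Proof. by case: z => a b /=; rewrite sqr_sqrtr// addr_ge0// sqr_ge0. Qed.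

Lemma normc_ge0 (R : rcfType) (z : R[i]) : 0 <= Normc.normc z.
Proof. by case: z => a b /=; exact: sqrtr_ge0. Qed.

Section TorusNikolskii.
Variables (R : realType) (d : nat).

(** The square of the modulus is a sum of two squares of trigonometric sums, hence within reach of
    the product rule for [bounded_lipschitz]. *)
Lemma trig_cross_bounded_lipschitz N (f : d.-tuple R -> R[i]) : trig_cross R d N f ->
  exists (h : seq R -> R) (B : R), bounded_lipschitz d h B /\
    forall x : d.-tuple R, h x = Normc.normc (f x) ^+ 2.
Proof.
move=> /trig_cross_trigsum[r [alpha [beta [phi [_ fE]]]]].
have rd i : i \in r -> size (i.1 : d.-tuple int) = d by move=> _; rewrite size_tuple.
have [B Bu] := bounded_lipschitz_trigsum alpha phi rd.
have [C Cv] := bounded_lipschitz_trigsum beta phi rd.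
have [B' Bu2] := bounded_lipschitzX 2 Bu; have [C' Cv2] := bounded_lipschitzX 2 Cv.
exists (fun x => trigsum r alpha phi (fun i => i.1) x ^+ 2 +
  trigsum r beta phi (fun i => i.1) x ^+ 2), (B' + C').
split; first exact: bounded_lipschitzD.
by move=> x; rewrite normc_sqr; have [-> ->] := fE x.
Qed.

Lemma trig_cross_measurable N (f : d.-tuple R -> R[i]) : trig_cross R d N f ->
  measurable_fun [set: lspace R d] (fun x : d.-tuple R => Normc.normc (f x)).
Proof.
move=> /trig_cross_bounded_lipschitz[h [B [[_ mh _ _] hE]]].
rewrite (_ : (fun x => _) = (fun x : d.-tuple R => h x `^ 2^-1)).
  exact: (measurableT_comp (measurable_powR 2^-1) mh).
by apply/funext => x; rewrite hE powR12_sqrt ?sqr_ge0// sqrtr_sqr ger0_norm ?normc_ge0.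
Qed.

Lemma trig_cross_integral_fin N (f : d.-tuple R -> R[i]) n : trig_cross R d N f ->
  (\int[torus_measure R d]_(x in torus R d) (Normc.normc (f x) ^+ (2 * n))%:E < +oo)%E.
Proof.
move=> /trig_cross_bounded_lipschitz[h [B [hB hE]]].
have [C hC] := bounded_lipschitzX n hB.
have [|H _] := riemann_sum (ltn0Sn 0) hC.
  by move=> x; rewrite exprn_ge0// hE exprn_ge0// normc_ge0.
under eq_integral do rewrite exprM -hE.
exact: le_lt_trans H (ltry _).
Qed.

(** For the even exponent [r = 2 * m.+2], [|f| ^ r] is a power of the Lipschitz function
    [u ^ 2 + v ^ 2], with [u] and [v] the real and imaginary parts. The grid inequality is applied
    to [u] and [v] separately, and the number of nodes then tends to infinity. *)
Lemma torus_nikolskii m : exists2 C : R, 0 < C &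
  forall N (f : d.-tuple R -> R[i]) (X Y : R), trig_cross R d N f ->
  (\int[torus_measure R d]_(x in torus R d) (Normc.normc (f x) ^+ (2 * (2 * m.+2)))%:E = X%:E)%E ->
  (\int[torus_measure R d]_(x in torus R d) (Normc.normc (f x) ^+ (2 * m.+2))%:E = Y%:E)%E ->
  X <= C * N%:R * Y ^+ 2.
Proof.
have [C0 C00 grid] := grid_nikolskii R d (2 * m).+1.
have rE : (2 * m).+1.+3 = (2 * m.+2)%N by lia.
rewrite rE in grid; set r := (2 * m.+2)%N in grid *.
(* The factor [2 ^+ r] comes from [exprD_le_max], and the 2 from adding the bounds for [u] and
   [v]. *)
pose C := 2 ^+ r * (2 * C0); have Cgt0 : 0 < C by apply: mulr_gt0; [exact: exprn_gt0|exact: mulr_gt0].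
exists C => // N f X Y fN.
have [s [alpha [beta [phi [sN fE]]]]] := trig_cross_trigsum fN.
have sd i : i \in s -> size (i.1 : d.-tuple int) = d by move=> _; rewrite size_tuple.
pose u := trigsum s alpha phi (fun i => i.1); pose v := trigsum s beta phi (fun i => i.1).
pose h x := u x ^+ 2 + v x ^+ 2.
have h0 x : 0 <= h x by rewrite addr_ge0// sqr_ge0.
have hE (x : d.-tuple R) : h x = Normc.normc (f x) ^+ 2.
  by rewrite normc_sqr; have [-> ->] := fE x.
have [B hB] : exists B, bounded_lipschitz d h B.
  have [Bu uB] := bounded_lipschitz_trigsum alpha phi sd.
  have [Bv vB] := bounded_lipschitz_trigsum beta phi sd.
  have [Bu' uB'] := bounded_lipschitzX 2 uB; have [Bv' vB'] := bounded_lipschitzX 2 vB.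
  by exists (Bu' + Bv'); exact: bounded_lipschitzD.
have [Br hBr] := bounded_lipschitzX r hB; have [Bm hBm] := bounded_lipschitzX m.+2 hB.
have [[Br0 _ _ _] [Bm0 _ _ _]] := (hBr, hBm).
under eq_integral do rewrite exprM -hE.
move=> XE; under eq_integral do rewrite exprM -hE.
move=> YE.
have [Mu gu] := grid N; have Mv := Mu; have gv := gu.
(* [D / n] collects the Riemann errors on both sides; the number of nodes is at least [n] and large
   enough for the grid inequality. *)
pose D := C * N%:R * (2 * Y * (Bm * (2 * pi)) + (Bm * (2 * pi)) ^+ 2) + Br * (2 * pi).
apply: (@le_div_nat _ _ _ D) => n n0; pose M := maxn n Mu.
have M0 : (0 < M)%N by rewrite leq_max n0.
have MuM : (Mu <= M)%N by rewrite leq_maxr.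
have nM : (n <= M)%N by rewrite leq_maxl.
have gridh : gavg M d (fun x => h x ^+ r) <= C * N%:R * gavg M d (fun x => h x ^+ m.+2) ^+ 2.
  have G (w : seq R -> R) : (forall x, w x ^+ 2 <= h x) ->
      gavg M d (fun x => `|w x| ^+ (2 * r)) <= C0 * N%:R * gavg M d (fun x => `|w x| ^+ r) ^+ 2 ->
      gavg M d (fun x => `|w x| ^+ (2 * r)) <= C0 * N%:R * gavg M d (fun x => h x ^+ m.+2) ^+ 2.
    move=> wh /le_trans; apply; rewrite ler_wpM2l ?mulr_ge0 ?(ltW C00)//.
    rewrite lerXn2r ?nnegrE//; try by apply: gavg_ge0 => x; rewrite exprn_ge0.
    apply: le_gavg => x _; rewrite /r exprM real_normK ?num_real//.
    by rewrite lerXn2r ?nnegrE ?sqr_ge0.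
  have Gu := G u (fun x => _) (gu M MuM _ s alpha phi (fun i => i.1) sd sN).
  have Gv := G v (fun x => _) (gu M MuM _ s beta phi (fun i => i.1) sd sN).
  apply: (@le_trans _ _ (2 ^+ r * (gavg M d (fun x => `|u x| ^+ (2 * r)) +
      gavg M d (fun x => `|v x| ^+ (2 * r))))).
    rewrite -gavgD -gavgZ; apply: le_gavg => x _.
    rewrite (le_trans (exprD_le_max _ (sqr_ge0 _) (sqr_ge0 _)))//.
    by rewrite !exprM !real_normK ?num_real.
  rewrite (_ : C * _ * _ = 2 ^+ r * (C0 * N%:R * gavg M d (fun x => h x ^+ m.+2) ^+ 2 +
     C0 * N%:R * gavg M d (fun x => h x ^+ m.+2) ^+ 2)); last by rewrite /C; ring.
  rewrite ler_wpM2l ?exprn_ge0// lerD//.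
    by apply: Gu => x; rewrite lerDl sqr_ge0.
  by apply: Gv => x; rewrite lerDr sqr_ge0.
have [|Xle _] := riemann_sum M0 hBr; first by move=> x; rewrite exprn_ge0.
have [|_ Yge] := riemann_sum M0 hBm; first by move=> x; rewrite exprn_ge0.
rewrite XE lee_fin in Xle; rewrite YE -EFinD lee_fin in Yge.
have Y0 : 0 <= Y.
  by rewrite -lee_fin -YE integral_ge0// => x _; rewrite lee_fin exprn_ge0.
have pi2 : 0 <= 2 * pi :> R by rewrite ltW// twopi_gt0.
have inv : M%:R^-1 <= n%:R^-1 :> R by rewrite lef_pV2 ?posrE ?ltr0n// ler_nat.
have e0 : 0 <= n%:R^-1 :> R by rewrite invr_ge0.
have e1 : n%:R^-1 <= 1 :> R by rewrite invf_le1 ?ltr0n// ler1n.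
move: (n%:R^-1) inv e0 e1 => e inv e0 e1.
have {}Xle : X <= gavg M d (fun x => h x ^+ r) + Br * (2 * pi) * e.
  by rewrite (le_trans Xle)// lerD2l ler_wpM2l// mulr_ge0.
set b := Bm * (2 * pi) in D Yge *; have b0 : 0 <= b by rewrite mulr_ge0.
have {}Yge : gavg M d (fun x => h x ^+ m.+2) <= Y + b * e.
  by rewrite (le_trans Yge)// lerD2l ler_wpM2l// mulr_ge0.
have G0 : 0 <= gavg M d (fun x => h x ^+ m.+2).
  by apply: gavg_ge0 => x; rewrite exprn_ge0.
have CN0 : 0 <= C * N%:R by rewrite mulr_ge0 ?(ltW Cgt0).
have Y2 : gavg M d (fun x => h x ^+ m.+2) ^+ 2 <= Y ^+ 2 + (2 * Y * b + b ^+ 2) * e.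
  apply: (@le_trans _ _ ((Y + b * e) ^+ 2)).
    by rewrite lerXn2r ?nnegrE// (le_trans G0).
  rewrite sqrrD exprMn -addrA lerD2l mulrDl lerD//.
    by rewrite -mulr_natl mulrA mulrA.
  by rewrite ler_wpM2l ?sqr_ge0// expr2 ler_piMr.
have := ler_wpM2l CN0 Y2; rewrite /D; lra.
Qed.

End TorusNikolskii.

(** * Truncation of the modulus, and the half-mass bound on small sets *)

Section Truncation.
Variable R : realType.
Implicit Types (a l q : R) (n : nat).

(** The first term suffices when [a <= l] and the second when [a >= l]. *)
Lemma exprn_le_truncation a l q n : 0 <= a -> 0 < l -> q <= n.+1%:R ->
  a ^+ n.+1 <= l `^ (n.+1%:R - q) * a `^ q + (l ^+ n.+1)^-1 * a ^+ (2 * n.+1).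
Proof.
move=> a0 l0 qn; have ln : 0 < l ^+ n.+1 by rewrite exprn_gt0.
have [al|/ltW la] := leP a l; last first.
  rewrite -[leLHS]add0r lerD ?mulr_ge0 ?powR_ge0//.
  rewrite mulrC ler_pdivlMr// mulnC exprM expr2.
  by rewrite ler_wpM2l ?exprn_ge0// lerXn2r ?nnegrE// ltW.
rewrite -[leLHS]addr0 lerD ?mulr_ge0 ?invr_ge0 ?exprn_ge0 ?(ltW l0)//.
have [->|an0] := eqVneq a 0; first by rewrite expr0n mulr_ge0 ?powR_ge0.
rewrite -powR_mulrn// -[in leLHS](subrK q n.+1%:R) (@powRD _ a) ?an0 ?implybT//.
by rewrite ler_wpM2r ?powR_ge0// ge0_ler_powR ?nnegrE ?subr_ge0// ltW.
Qed.

(** Again one term for each side of the height [l]. The factor 1 stands for the constant function,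
    whose integral over [B] will be the measure of [B]. *)
Lemma powR_le_truncation a l q n : 0 <= a -> 0 < l -> 0 < q -> q <= n%:R ->
  a `^ q <= l `^ q * 1 + l `^ (q - (2 * n)%:R) * a ^+ (2 * n).
Proof.
move=> a0 l0 q0 qn; rewrite mulr1; have [al|la] := leP a l.
  rewrite -[leLHS]addr0 lerD ?mulr_ge0 ?powR_ge0 ?exprn_ge0//.
  by rewrite ge0_ler_powR ?nnegrE// ltW.
rewrite -[leLHS]add0r lerD ?powR_ge0//.
have an0 : a != 0 by rewrite gt_eqF// (lt_trans l0).
rewrite -powR_mulrn// -[in leLHS](subrK (2 * n)%:R q) (@powRD _ a) ?an0 ?implybT//.
rewrite ler_wpM2r ?powR_ge0//.
have q2n : 0 <= (2 * n)%:R - q by rewrite natrM subr_ge0; lra.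
rewrite -opprB !powRN lef_pV2 ?posrE ?powR_gt0// ?(lt_trans l0)//.
by rewrite ge0_ler_powR ?nnegrE// ltW.
Qed.

(* [QB], [Q], [Y], [X] stand for the integrals of [|f|^q] on [B], and of
   [|f|^q], [|f|^r], [|f|^(2r)] on the torus, with [r = n.+1]; the truncation
   height is [l] for [H1] and [A * l] for [H3], where [l ^ r = 2 kappa Y]. *)
Lemma small_set_half (q kappa QB Q X Y beta A : R) n :
  0 < q -> q <= n.+1%:R -> 0 < kappa -> 0 <= Q -> 0 <= Y -> 0 <= X -> 0 <= beta -> 0 < A ->
  (forall l, 0 < l -> Y <= l `^ (n.+1%:R - q) * Q + (l ^+ n.+1)^-1 * X) ->
  X <= kappa * Y ^+ 2 ->
  (forall l, 0 < l -> QB <= l `^ q * beta + l `^ (q - (2 * n.+1)%:R) * X) ->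
  QB <= Q -> A `^ (q - (2 * n.+1)%:R) <= 4^-1 -> beta <= 1 ->
  16 * kappa * A `^ q * beta <= 1 ->
  QB <= Q / 2.
Proof.
move=> q0 qn k0 Q0 Y0 X0 b0 A0 H1 H2 H3 QBQ A4 b1 bA.
have [Q00|Qn0] := eqVneq Q 0; first by lra.
have Qgt0 : 0 < Q by rewrite lt_neqAle eq_sym Qn0.
(* If [Y = 0] then [X = 0], and the height with [l ^ q = Q / 2] is enough since [beta <= 1]. *)
have [Y00|Yn0] := eqVneq Y 0.
  have X00 : X = 0 by apply/eqP; rewrite eq_le X0 andbT (le_trans H2)// Y00 expr0n mulr0.
  have Q2 : 0 < Q / 2 by rewrite divr_gt0.
  have := H3 _ (powR_gt0 q^-1 Q2); rewrite -powRrM mulVf ?gt_eqF// powRr1 ?(ltW Q2)//.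
  by rewrite X00 mulr0 addr0 => /le_trans; apply; rewrite ler_piMr// ltW.
have Ygt0 : 0 < Y by rewrite lt_neqAle eq_sym Yn0.
have kY : 0 < 2 * kappa * Y by rewrite mulr_gt0 ?mulr_gt0.
(* At this height the last term of [H1] is at most [Y / 2] and is absorbed, which leaves
   [Y <= 2 l^(r - q) Q]. *)
pose l := (2 * kappa * Y) `^ (n.+1%:R^-1).
have l0 : 0 < l by exact: powR_gt0.
have ln : l ^+ n.+1 = 2 * kappa * Y.
  by rewrite -powR_mulrn ?powR_ge0// -powRrM mulVf ?powRr1 ?(ltW kY)// pnatr_eq0.
have hX : (l ^+ n.+1)^-1 * X <= Y / 2.
  rewrite ln mulrC ler_pdivrMr// (le_trans H2)// le_eqVlt; apply/orP; left; apply/eqP.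
  by rewrite expr2; field.
pose p := l `^ (n.+1%:R - q); have p0 : 0 < p by exact: powR_gt0.
have Yp : Y <= 2 * (p * Q) by have := H1 _ l0; rewrite -/p; lra.
have lnR : l `^ n.+1%:R = 2 * kappa * Y by rewrite powR_mulrn ?(ltW l0).
have lq : l `^ q * p = 2 * kappa * Y.
  by rewrite /p -powRD ?(gt_eqF l0) ?implybT// addrC subrK.
have lqQ : l `^ q <= 4 * kappa * Q.
  rewrite -(ler_pM2r p0) lq.
  rewrite (_ : 4 * kappa * Q * p = 2 * kappa * (2 * (p * Q))); last by ring.
  by rewrite ler_pM2l// mulr_gt0.
have lq2 : l `^ (q - (2 * n.+1)%:R) * (kappa * Y ^+ 2) <= Q.
  have E : l `^ (q - (2 * n.+1)%:R) * (p * (2 * kappa * Y)) = 1.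
    rewrite -lnR /p -!powRD ?(gt_eqF l0) ?implybT//.
    by rewrite (_ : q - _ + _ = 0) ?powRr0// natrM; ring.
  have pk0 : 0 < p * (2 * kappa * Y) by rewrite mulr_gt0.
  rewrite -(ler_pM2l pk0) [leLHS]mulrA [p * _ * l `^ _]mulrC E mul1r.
  rewrite (_ : p * _ * Q = kappa * Y * (2 * (p * Q))); last by ring.
  by rewrite expr2 mulrA ler_pM2l// mulr_gt0.
(* At the height [A * l] the first term of [H3] is at most [Q / 4] because [beta] is small, the
   second because of the power of [A]. *)
have Al0 : 0 < A * l by rewrite mulr_gt0.
have := H3 _ Al0; rewrite !powRM ?(ltW A0) ?(ltW l0)// => /le_trans; apply.
have t1 : A `^ q * l `^ q * beta <= Q / 4.
  apply: (@le_trans _ _ (A `^ q * (4 * kappa * Q) * beta)).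
    by rewrite ler_wpM2r// ler_wpM2l ?powR_ge0.
  have := ler_wpM2l (ltW Qgt0) bA; lra.
have t2 : A `^ (q - (2 * n.+1)%:R) * l `^ (q - (2 * n.+1)%:R) * X <= Q / 4.
  apply: (@le_trans _ _ (A `^ (q - (2 * n.+1)%:R) * Q)).
    rewrite -mulrA ler_wpM2l ?powR_ge0// (le_trans _ lq2)// ler_wpM2l ?powR_ge0//.
  by rewrite mulrC ler_wpM2l// ltW.
lra.
Qed.

End Truncation.

(** * From the Nikolskii inequality to the comparison of the two norms *)

Lemma ge0_integral_le_comb d (T : measurableType d) (R : realType)
    (mu : {measure set T -> \bar R}) (D : set T) (F G H : T -> R) (a b : R) :
  measurable D -> measurable_fun [set: T] F -> measurable_fun [set: T] G ->
  measurable_fun [set: T] H -> 0 <= a -> 0 <= b ->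
  (forall x, 0 <= F x) -> (forall x, 0 <= G x) -> (forall x, 0 <= H x) ->
  (forall x, F x <= a * G x + b * H x) ->
  (\int[mu]_(x in D) (F x)%:E <=
   a%:E * \int[mu]_(x in D) (G x)%:E + b%:E * \int[mu]_(x in D) (H x)%:E)%E.
Proof.
move=> mD mF mG mH a0 b0 F0 G0 H0 FGH.
have mE (K : T -> R) : measurable_fun [set: T] K -> measurable_fun D (fun x => (K x)%:E).
  by move=> mK; apply: measurable_funTS; exact/measurable_EFinP.
have maG : measurable_fun [set: T] (fun x => a * G x) by exact: measurable_funM.
have mbH : measurable_fun [set: T] (fun x => b * H x) by exact: measurable_funM.
have E0 (K : T -> R) : (forall x, 0 <= K x) -> forall x, D x -> (0 <= (K x)%:E)%E.
  by move=> K0 x _; rewrite lee_fin.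
rewrite -(ge0_integralZl_EFin mu mD (E0 _ G0) (mE _ mG) a0).
rewrite -(ge0_integralZl_EFin mu mD (E0 _ H0) (mE _ mH) b0).
rewrite -(ge0_integralD mu mD (E0 _ (fun x => mulr_ge0 a0 (G0 x))) (mE _ maG)
  (E0 _ (fun x => mulr_ge0 b0 (H0 x))) (mE _ mbH)).
apply: (ge0_le_integral mu mD (E0 _ F0) (mE _ mF)).
  by apply: (mE (fun x => a * G x + b * H x)); exact: measurable_funD.
by move=> x _; rewrite -EFinD lee_fin.
Qed.

Theorem theorem3p2 (R : realType) (d : nat) (q : R) (hd : (1 <= d)%N)
    (hq : 0 < q) :
  exists C1 C2 : R, 0 < C1 /\ 0 < C2 /\
    forall (N : nat) (B : set (lspace R d)) (f : d.-tuple R -> R[i]),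
      (1 <= N)%N ->
      measurable B ->
      B `<=` torus R d ->
      (torus_measure R d B <= ((C2 * N%:R)^-1)%:E)%E ->
      trig_cross R d N f ->
      (Lq_norm q (torus R d) f <= C1%:E * Lq_norm q (torus R d `\` B) f)%E.
Proof.
(* The exponent [r = n.+1 = 2 * m.+2] is even, as [torus_nikolskii] requires, and at least [q]. *)
pose m := Num.truncn q; pose n := (2 * m + 3)%N.
have nE : n.+1 = (2 * m.+2)%N by rewrite /n; lia.
have qn : q <= n.+1%:R.
  by rewrite (le_trans (ltW (truncnS_gt q)))// ler_nat -/m nE mulnC muln2 -addnn ltnW// ltn_addl.
have [C C0 nik] := torus_nikolskii R d m; rewrite -nE in nik.
have q2n : 0 < (2 * n.+1)%:R - q.
  by rewrite subr_gt0 (le_lt_trans qn)// ltr_nat ltn_Pmull.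
(* Chosen so that [A] to the power [q - 2r] is exactly [1 / 4]. *)
pose A : R := 4 `^ (((2 * n.+1)%:R - q)^-1).
have A0 : 0 < A by exact: powR_gt0.
have A4 : A `^ (q - (2 * n.+1)%:R) <= 4^-1.
  by rewrite -opprB powRN -powRrM mulVf ?gt_eqF// powRr1.
(* The summand 1 ensures that [B] has measure at most 1; the other summand is the smallness
   condition of [small_set_half] with [kappa = C * N]. *)
pose C2 := 1 + 16 * C * A `^ q.
have CA0 : 0 <= 16 * C * A `^ q by rewrite mulr_ge0 ?powR_ge0// mulr_ge0// ltW.
have C20 : 0 < C2 by rewrite /C2; lra.
(* [B] will carry at most half of the integral of [|f| ^ q], so the complement carries at least
   half; the root of order [q] turns this 2 into the first constant. *)
exists (2 `^ q^-1), C2; split; first exact: powR_gt0; split=> // N B f N1 mB BT muB fN.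
have N0 : 0 < N%:R :> R by rewrite ltr0n.
pose g (x : lspace R d) := Normc.normc (f x).
have g0 x : 0 <= g x by exact: normc_ge0.
have mg : measurable_fun [set: lspace R d] g := trig_cross_measurable fN.
have mgX k : measurable_fun [set: lspace R d] (fun x => g x ^+ k) by exact: measurable_funX.
have mgq : measurable_fun [set: lspace R d] (fun x => g x `^ q).
  exact: (measurableT_comp (measurable_powR q) mg).
have mgqE : measurable_fun [set: lspace R d] (fun x => (g x `^ q)%:E).
  exact/measurable_EFinP.
have mgXE k : measurable_fun [set: lspace R d] (fun x => (g x ^+ k)%:E).
  exact/measurable_EFinP.
have gqE0 x : (0 <= (g x `^ q)%:E)%E by rewrite lee_fin powR_ge0.
have gXE0 k x : (0 <= (g x ^+ k)%:E)%E by rewrite lee_fin exprn_ge0.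
have mT : measurable (torus R d) := @measurable_torus R d.
pose mu := torus_measure R d.
pose I k := (\int[mu]_(x in torus R d) (g x ^+ k)%:E)%E.
have I0 k : (0 <= I k)%E by apply: integral_ge0 => x _; rewrite lee_fin exprn_ge0.
have Ifin k : I (2 * k)%N \is a fin_num.
  by rewrite ge0_fin_numE//; exact: trig_cross_integral_fin fN.
pose Y := fine (I n.+1); pose X := fine (I (2 * n.+1)%N).
have YE : I n.+1 = Y%:E by rewrite /Y fineK// nE Ifin.
have XE : I (2 * n.+1)%N = X%:E by rewrite /X fineK// Ifin.
have H2 := nik N f X Y fN XE YE.
pose J (D : set (lspace R d)) := (\int[mu]_(x in D) (g x `^ q)%:E)%E.
have J0 D : (0 <= J D)%E by apply: integral_ge0 => x _; rewrite lee_fin powR_ge0.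
have muT : mu (torus R d) = 1%E := torus_measure_torus R d.
have trunc D l : measurable D -> D `<=` torus R d -> 0 < l ->
    (J D <= (l `^ q)%:E * mu D + (l `^ (q - (2 * n.+1)%:R))%:E * X%:E)%E.
  move=> mD DT l0; rewrite -XE.
  apply: (@le_trans _ _ ((l `^ q)%:E * mu D +
      (l `^ (q - (2 * n.+1)%:R))%:E * \int[mu]_(x in D) (g x ^+ (2 * n.+1))%:E)%E).
    rewrite -[mu D]mul1e -integral_cst//.
    exact: (@ge0_integral_le_comb _ _ _ mu D (fun x => g x `^ q) (fun=> 1)
      (fun x => g x ^+ (2 * n.+1)) _ _ mD mgq (measurable_cst _) (mgX _)
      (powR_ge0 _ _) (powR_ge0 _ _) (fun x => powR_ge0 _ _) (fun=> ler01)
      (fun x => exprn_ge0 _ (g0 x)) (fun x => powR_le_truncation (g0 x) l0 hq qn)).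
  apply: leeD => //; apply: lee_wpmul2l; first by rewrite lee_fin powR_ge0.
  exact: (ge0_subset_integral mu mD mT (measurable_funTS (mgXE _)) (fun x _ => gXE0 _ x) DT).
(* Truncation at height 1 gives finiteness, so that the remaining comparison can be made between
   real numbers. *)
have JTfin : J (torus R d) \is a fin_num.
  rewrite ge0_fin_numE// (le_lt_trans (trunc _ 1 mT _ ltr01))//.
  by rewrite muT mule1 -EFinM -EFinD ltry.
have JBT : (J B <= J (torus R d))%E.
  exact: (ge0_subset_integral mu mB mT (measurable_funTS mgqE) (fun x _ => gqE0 x) BT).
have JBfin : J B \is a fin_num.
  by rewrite ge0_fin_numE// (le_lt_trans JBT)// -ge0_fin_numE.
have muBfin : mu B \is a fin_num.
  by rewrite ge0_fin_numE// (le_lt_trans muB)// ltry.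
pose beta := fine (mu B); have muBE : mu B = beta%:E by rewrite fineK.
have b0 : 0 <= beta by rewrite fine_ge0.
have CN : 1 <= C2 * N%:R.
  have C21 : 1 <= C2 by rewrite lerDl.
  by apply: (le_trans C21); apply: ler_peMr; [exact: ltW|rewrite ler1n].
have bC : beta * (C2 * N%:R) <= 1.
  rewrite -ler_pdivlMr ?mulr_gt0// div1r -lee_fin -muBE; exact: muB.
have half : fine (J B) <= fine (J (torus R d)) / 2.
  apply: (@small_set_half R q (C * N%:R) _ _ X Y beta A n) => //.
  - by rewrite mulr_gt0.
  - by rewrite fine_ge0.
  - by rewrite fine_ge0.
  - by rewrite fine_ge0.
  - move=> l l0; rewrite -lee_fin -YE EFinD !EFinM fineK// -XE.
    have li0 : 0 <= (l ^+ n.+1)^-1 by rewrite invr_ge0 exprn_ge0// ltW.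
    exact: (@ge0_integral_le_comb _ _ _ mu _ (fun x => g x ^+ n.+1) (fun x => g x `^ q)
      (fun x => g x ^+ (2 * n.+1)) _ _ mT (mgX _) mgq (mgX _) (powR_ge0 _ _) li0
      (fun x => exprn_ge0 _ (g0 x)) (fun x => powR_ge0 _ _)
      (fun x => exprn_ge0 _ (g0 x)) (fun x => exprn_le_truncation (g0 x) l0 qn)).
  - move=> l l0; rewrite -lee_fin fineK// EFinD !EFinM -muBE; exact: trunc.
  - by rewrite fine_le.
  - by rewrite (le_trans _ bC)// ler_peMr.
  - rewrite (le_trans _ bC)// (_ : _ * beta = beta * (16 * C * A `^ q * N%:R)); last by ring.
    by apply: ler_wpM2l b0 _ _ _; apply: ler_wpM2r; [exact: ltW|rewrite lerDr].
have split : J (torus R d) = (J B + J (torus R d `\` B))%E.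
  have BD : [disjoint B & torus R d `\` B] by rewrite disj_set2E setDIK.
  have := ge0_integral_setU mu mB (measurableD mT mB) (measurable_funTS mgqE)
    (fun x _ => gqE0 x) BD.
  by rewrite setDUK.
have JDfin : J (torus R d `\` B) \is a fin_num.
  by rewrite ge0_fin_numE// (le_lt_trans _ (_ : J (torus R d) < +oo)%E) -?ge0_fin_numE//
    split leeDr.
have main : (J (torus R d) <= 2%:E * J (torus R d `\` B))%E.
  have : fine (J (torus R d)) = fine (J B) + fine (J (torus R d `\` B)).
    by rewrite [in LHS]split fineD.
  move=> E; rewrite -(fineK JTfin) -(fineK JDfin) -EFinM lee_fin.
  move: E half; move: (fine (J (torus R d))) (fine (J B)) (fine (J (torus R d `\` B))).
  by clear=> a b c; lra.
have r0 : 0 <= q^-1 by rewrite invr_ge0 ltW.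
apply: (@le_trans _ _ ((2%:E * J (torus R d `\` B)) `^ q^-1)%E).
  apply: (gt0_ler_poweR r0 _ _ main); rewrite in_itv/= ?J0 ?leey//.
  by rewrite mule_ge0// J0.
by rewrite poweRM ?J0// poweR_EFin.
Qed.
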